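(* Let $\Bbbk$ be a field and $m\ge 2$. Golodness is a uniform property across the faces of the Kunz cone $C_m$; that is, for each face of $C_m$, either all numerical semigroups of multiplicity $m$ lying in that face give rise to Golod semigroup rings over $\Bbbk$ or none do.
   Context: A numerical semigroup is a cofinite additively closed set $S \subseteq \mathbb Z_{\ge 0}$ containing $0$; its multiplicity is $m = \min(S\setminus\{0\})$. Its Apéry set is $\operatorname{Ap}(S) = \{n \in S : n - m \notin S\} = \{0, a_1, \ldots, a_{m-1}\}$ with $a_i \equiv i \bmod m$. The Kunz cone $C_m \subseteq \mathbb R_{\ge 0}^{m-1}$ is the polyhedral cone defined by the inequalities $z_i + z_j \ge z_{i+j}$ for all $i,j \in \{1,\ldots,m-1\}$ with $i+j \not\equiv 0 \bmod m$ (subscripts modulo $m$). A numerical semigroup $S$ of multiplicity $m$ lies in a face $F$ of $C_m$ if $(a_1,\ldots,a_{m-1})$ lies in the relative interior of $F$. The semigroup ring of $S$ is $R = \Bbbk[S] = \Bbbk[t^s : s\in S]$. Let $n_1,\ldots,n_n$ be the minimal generators of $S$ (so $n$ is their number), let $Q$ be the polynomial ring over $\Bbbk$ in $n$ variables, graded so that the $k$-th variable has degree $n_k$, and let $I$ be the kernel of the surjection $Q \to R$ sending the $k$-th variable to $t^{n_k}$, so $R = Q/I$. Write $\beta_i^R(\Bbbk) = \dim_{\Bbbk}\operatorname{Tor}_i^R(\Bbbk,\Bbbk)$, $P^R_{\Bbbk}(z) = \sum_{i\ge0}\beta_i^R(\Bbbk)z^i$, $\beta_i^Q(I) = \dim_{\Bbbk}\operatorname{Tor}_i^Q(I,\Bbbk)$,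 and $P^Q_I(z) = \sum_{i\ge 0}\beta_i^Q(I)z^i$. The ring $R$ is Golod when $$P^R_{\Bbbk}(z) = \frac{(1+z)^n}{1 - z^2 P^Q_I(z)}.$$ *)

(* Defs.v *)
From HB Require Import structures.
From mathcomp Require Import all_boot all_order all_algebra.
From mathcomp Require Import mpoly.
From mathcomp Require Import boolp classical_sets reals.
Set Implicit Arguments.
Unset Strict Implicit.
Unset Printing Implicit Defensive.
Import GRing.Theory Num.Theory.
Local Open Scope classical_set_scope.
Local Open Scope ring_scope.

(* Cofinite sets are decidable, so [pred nat] loses no generality. *)
Record numsg := Numsg {
  numsg_pred :> pred nat;
  numsg0 : numsg_pred 0%N;
  numsgD : forall s t, numsg_pred s -> numsg_pred t -> numsg_pred (s + t)%N;
  numsg_cofinite : exists N, forall s, (N <= s)%N -> numsg_pred s }.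

Definition is_multiplicity (S : numsg) (m : nat) : Prop :=
  [/\ (0 < m)%N, S m & forall s, S s -> (0 < s)%N -> (m <= s)%N].

(* The guard [m <= s] corrects for truncated subtraction: a negative [s - m]
   is not in [S]. *)
Definition apery (S : numsg) (m : nat) : pred nat :=
  [pred s | S s && ~~ ((m <= s)%N && S (s - m)%N)].

Definition generates n (S : numsg) (g : 'I_n -> nat) (D : pred 'I_n) : Prop :=
  forall s, S s <-> exists c : 'I_n -> nat, s = (\sum_(j | D j) c j * g j)%N.

(* [g] lists, without repetition, the minimal generating set of [S]. *)
Definition is_mingens n (S : numsg) (g : 'I_n -> nat) : Prop :=
  generates S g predT /\ forall D, generates S g D -> forall i, D i.

Section Cone.
Variable (R : realType).

(* Coordinate [i : 'I_m.-1] of a row vector stands for z_(i+1); given i and j,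
   an index l as below exists exactly when i+1 + j+1 is nonzero modulo m. *)
Definition kunz_cone (m : nat) : set 'rV[R]_m.-1 :=
  [set z : 'rV[R]_m.-1 | (forall i, 0 <= z 0 i) /\
    forall i j l : 'I_m.-1, (i.+1 + j.+1 = l.+1 %[mod m])%N ->
      z 0 i + z 0 j >= z 0 l].

Variable d : nat.
Implicit Types C F A : set 'rV[R]_d.

(* Faces are cut out by supporting hyperplanes; l = 0 gives C itself.  The
   hyperplanes are linear because C is a cone. *)
Definition is_face C F : Prop :=
  exists2 l : 'cV[R]_d, forall z, C z -> 0 <= (z *m l) 0 0 &
    F = [set z | C z /\ (z *m l) 0 0 = 0].

Definition affine_hull A : set 'rV[R]_d :=
  [set z | exists (n : nat) (c : 'I_n -> R) (p : 'I_n -> 'rV[R]_d),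
    [/\ forall i, A (p i), \sum_i c i = 1 & z = \sum_i c i *: p i]].

(* Interior relative to the affine hull, with sup-norm balls. *)
Definition relint A : set 'rV[R]_d :=
  [set z | A z /\ exists2 e : R, 0 < e &
    forall y, affine_hull A y -> (forall i, `|y 0 i - z 0 i| < e) -> A y].

End Cone.
Arguments kunz_cone R m : clear implicits.

Definition lies_in_face (R : realType) (m : nat) (S : numsg)
    (F : set 'rV[R]_m.-1) : Prop :=
  exists a : 'I_m.-1 -> nat,
    (forall i, apery S m (a i) /\ a i = i.+1 %[mod m]) /\
    relint F (\row_i (a i)%:R).

Section SemigroupRing.
Variables (k : fieldType) (S : numsg).

Definition sgpoly : {pred {poly k}} :=
  fun p => all (fun i => (p`_i != 0) ==> S i) (iota 0 (size p)).

Lemma sgpolyP (p : {poly k}) :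
  reflect (forall i, p`_i != 0 -> S i) (p \in sgpoly).
Proof.
apply: (iffP allP) => [H i pi0|H i _]; last by apply/implyP/H.
apply: (implyP (H i _) pi0); rewrite mem_iota /= add0n.
by case: ltnP => // le_pi; rewrite nth_default ?eqxx in pi0.
Qed.

Fact sgpoly_subalg : subalg_closed sgpoly.
Proof.
split=> [|a p q /sgpolyP Sp /sgpolyP Sq|p q /sgpolyP Sp /sgpolyP Sq].
- apply/sgpolyP=> i; rewrite coef1; case: i => [|i] /=; last by rewrite eqxx.
  by move=> _; exact: numsg0.
- apply/sgpolyP=> i; rewrite coefD coefZ => nz.
  have [qi0|] := eqVneq q`_i 0; last exact: Sq.
  by apply: Sp; apply: contraNneq nz => ->; rewrite qi0 mulr0 addr0.
- apply/sgpolyP=> i; rewrite coefM => nz.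
  have [j /andP[pj qj]] : exists j : 'I_i.+1, (p`_j != 0) && (q`_(i - j) != 0).
    apply/existsP; apply: contraNT nz; rewrite negb_exists => /forallP H.
    rewrite big1 // => j _; have := H j.
    by rewrite negb_and !negbK => /orP[] /eqP->; rewrite ?mul0r ?mulr0.
  by rewrite -(subnKC (leq_ord j)); apply: numsgD; [exact: Sp|exact: Sq].
Qed.

HB.instance Definition _ :=
  GRing.isSubalgClosed.Build k {poly k} sgpoly sgpoly_subalg.

Record sgring := SGRing { sgval : {poly k}; _ : sgval \in sgpoly }.

HB.instance Definition _ := [isSub for sgval].
HB.instance Definition _ := [Choice of sgring by <:].
HB.instance Definition _ := [SubChoice_isSubAlgebra of sgring by <:].
HB.instance Definition _ := [SubNzRing_isSubComNzRing of sgring by <:].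

(* t^s when s lies in S, and 0 otherwise. *)
Definition sgmon (s : nat) : sgring := insubd (0 : sgring) 'X^s.

(* Reduction of k[S] modulo its graded maximal ideal (t^s : s <> 0). *)
Definition sgaug : {rmorphism sgring -> k} :=
  coefp 0 \o (val : sgring -> {poly k}).

(* k[x_1, ..., x_n] -> k[S], x_j |-> t^(g j). *)
Definition sgpres n (g : 'I_n -> nat) (p : {mpoly k[n]}) : sgring :=
  mmap (in_alg sgring) (fun j => sgmon (g j)) p.

End SemigroupRing.

(* Reduction of k[x_1, ..., x_n] modulo (x_1, ..., x_n). *)
Definition polyaug (k : fieldType) n : {rmorphism {mpoly k[n]} -> k} :=
  mcoeff 0%MM.

Section Tor.
Variables (k : fieldType) (A : comNzRingType).

(* k regarded as an A-module through eps. *)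
Definition residue (eps : {rmorphism A -> k}) : Type := k.

Section Residue.
Variable eps : {rmorphism A -> k}.
HB.instance Definition _ := GRing.Zmodule.on (residue eps).
Definition residue_scale (a : A) (v : residue eps) : residue eps := eps a * v.
Fact residue_scaleA a b v :
  residue_scale a (residue_scale b v) = residue_scale (a * b) v.
Proof. by rewrite /residue_scale rmorphM mulrA. Qed.
Fact residue_scale1 : left_id 1 residue_scale.
Proof. by move=> v; rewrite /residue_scale rmorph1 mul1r. Qed.
Fact residue_scaleDr : right_distributive residue_scale +%R.
Proof. by move=> a v w; rewrite /residue_scale mulrDr. Qed.
Fact residue_scaleDl v : {morph residue_scale^~ v : a b / a + b}.
Proof. by move=> a b; rewrite /residue_scale rmorphD mulrDl. Qed.
HB.instance Definition _ := GRing.Zmodule_isLmodule.Build A (residue eps)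
  residue_scaleA residue_scale1 residue_scaleDr residue_scaleDl.
End Residue.

(* Resolutions  ... -> A^(rk 2) -> A^(rk 1) -> A^(rk 0) -> M -> 0  of a
   submodule M of V by finitely generated free modules.  Elements of A^r are
   row vectors, on which matrices act from the right; [dif i] is the
   differential from degree i.+1 to degree i. *)
Record free_resolution (V : lmodType A) (M : set V) := FreeResolution {
  rk : nat -> nat;
  dif : forall i, 'M[A]_(rk i.+1, rk i);
  aug : {linear 'rV[A]_(rk 0) -> V};
  aug_image : range aug = M;
  aug_exact : forall x : 'rV[A]_(rk 0),
    aug x = 0 <-> exists y, x = y *m dif 0;
  dif_exact : forall i (x : 'rV[A]_(rk i.+1)),
    x *m dif i = 0 <-> exists y, x = y *m dif i.+1 }.

(* dim_k Tor_i^A(M, k) is the dimension of the homology in degree i of the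
   complex of k-vector spaces F (x)_A k, whose differentials are the matrices
   of F reduced along eps. *)
Definition tor_dim (eps : {rmorphism A -> k}) (V : lmodType A) (M : set V)
    (F : free_resolution M) (i : nat) : nat :=
  let d j := map_mx eps (dif F j) in
  match i with
  | 0 => rk F 0 - \rank (d 0)
  | j.+1 => \rank (kermx (d j)) - \rank (d j.+1)
  end%N.

End Tor.

(* Formal power series over the integers, as coefficient sequences. *)
Definition psmul (f h : nat -> int) (i : nat) : int :=
  \sum_(j < i.+1) f j * h (i - j)%N.

(* 1 - z^2 f(z) *)
Definition one_sub_z2 (f : nat -> int) (i : nat) : int :=
  (i == 0%N)%:R - (if i is j.+2 then f j else 0).

(* F resolves k over k[S], and G resolves the kernel of sgpres over
   k[x_1, ..., x_n].  Both exist, the rings being Noetherian, and the Tor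
   dimensions do not depend on them.  The defining identity of power series is
   multiplied by its denominator, which has constant term 1. *)
Definition golod (k : fieldType) (S : numsg) : Prop :=
  exists (n : nat) (g : 'I_n -> nat)
    (F : free_resolution [set: residue (sgaug k S)])
    (G : free_resolution [set p : {mpoly k[n]}^o | sgpres S g p = 0]),
    is_mingens S g /\
    let PRk i := (tor_dim (sgaug k S) F i)%:Z in
    let PQI i := (tor_dim (polyaug k n) G i)%:Z in
    forall i, psmul PRk (one_sub_z2 PQI) i = ((1 + 'X) ^+ n : {poly int})`_i.

(* Main.v *)
From HB Require Import structures.
Require Import Defs.
From mathcomp Require Import all_boot all_order all_algebra.
From mathcomp Require Import zify lra.
From mathcomp Require Import mpoly.
From mathcomp Require Import boolp classical_sets reals.
Set Implicit Arguments.
Unset Strict Implicit.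
Unset Printing Implicit Defensive.
Import Order.TTheory GRing.Theory Num.Theory.
Local Open Scope classical_set_scope.
Local Open Scope ring_scope.

(** Why Golodness depends only on the face.

Let S and T be numerical semigroups of multiplicity m in the relative interior
of one face, with Apery elements a_i and b_i, where a_0 = b_0 = 0.  The defining
inequalities that are tight at a point of the relative interior of a face are
tight on the whole face, so a_i + a_j = a_(i+j) exactly when
b_i + b_j = b_(i+j) ([face_kunz_equiv]).  Write x for t^m.  Modulo x the ring
k[S] has the basis t^(a_i), and t^(a_i) t^(a_j) is t^(a_(i+j)) or 0 according to
whether a_i + a_j = a_(i+j).  Hence k[S]/(x) and k[T]/(x) are isomorphic, by t^(b_i)
|-> t^(a_i); call this ring C ([common_reduction]).

Both families of Betti numbers in the definition of Golodness can be read off C.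
The tool is that a free resolution of M over A stays a free resolution, now of
M/xM over A/(x), if x is regular on A and on M ([regular_reduction]); the
reduced differentials are the same, hence so are the Tor dimensions.
 - For the residue field, take M to be the maximal ideal of k[S].  It is a first
   syzygy of k, so it carries all Betti numbers of k but the zeroth, which is 1
   ([augmentation_resolution]).  As a module over C, M/xM is the direct sum of k,
   spanned by the class of x, and of the maximal ideal of C
   ([maximal_ideal_reduction]).
 - For the defining ideal I of k[S] in the polynomial ring Q, one of the
   variables maps to x, and setting it to 0 turns I into the kernel of a map
   from a polynomial ring to C ([defining_ideal_reduction]).  The minimal
   generators of T other than m are the Apery elements that correspond to those
   of S ([mingens_transfer]), so that both semigroups give the same kernel.

Comparing the two semigroups over C then needs that Tor dimensions do not depend
on the resolution ([tor_dim_resolution]), and that resolutions over k[T] and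
over Q exist, which follows from Hilbert's basis theorem ([noetherian_poly],
[resolution_exists]). *)

(** * Noetherian modules and existence of resolutions *)

Definition submodule (A : comNzRingType) (V : lmodType A) (N : set V) : Prop :=
  N 0 /\ forall a u v, N u -> N v -> N (a *: u + v).

Definition fin_gen (A : comNzRingType) (V : lmodType A) (N : set V) : Prop :=
  exists n (h : 'I_n -> V),
    forall v, N v <-> exists c : 'I_n -> A, v = \sum_i c i *: h i.

Definition noetherian (A : comNzRingType) (V : lmodType A) : Prop :=
  forall N : set V, submodule N -> fin_gen N.

Section Submodules.
Variables (A : comNzRingType) (V : lmodType A).
Implicit Types N : set V.

Lemma submoduleZ N a u : submodule N -> N u -> N (a *: u).
Proof. by move=> [N0 Nl] Nu; rewrite -[_ *: _]addr0; apply: Nl. Qed.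

Lemma submoduleD N u v : submodule N -> N u -> N v -> N (u + v).
Proof. by move=> [N0 Nl] Nu Nv; rewrite -[u]scale1r; apply: Nl. Qed.

Lemma submoduleB N u v : submodule N -> N u -> N v -> N (u - v).
Proof. by move=> Ns Nu Nv; rewrite addrC -scaleN1r; apply: Ns.2. Qed.

Lemma submodule_sum N n (c : 'I_n -> A) (h : 'I_n -> V) :
  submodule N -> (forall i, N (h i)) -> N (\sum_i c i *: h i).
Proof.
move=> Ns Nh; elim/big_ind: _ => //; first exact: Ns.1.
  by move=> u v; apply: submoduleD.
by move=> i _; apply: submoduleZ.
Qed.

Lemma fin_gen_gens N n (h : 'I_n -> V) :
    (forall v, N v <-> exists c : 'I_n -> A, v = \sum_i c i *: h i) ->
  forall i, N (h i).
Proof.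
move=> Nh i; apply/Nh; exists (fun j => (j == i)%:R).
rewrite (bigD1 i) //= eqxx scale1r big1 ?addr0 // => j /negbTE->.
by rewrite scale0r.
Qed.

Lemma fin_genI N n (h : 'I_n -> V) : submodule N -> (forall i, N (h i)) ->
    (forall v, N v -> exists c : 'I_n -> A, v = \sum_i c i *: h i) ->
  fin_gen N.
Proof.
move=> Ns Nh gen; exists n, h => v; split; first exact: gen.
by move=> [c ->]; apply: submodule_sum.
Qed.

End Submodules.

(** Generators of the image of N, lifted to N, together with generators of the
    part of N in the kernel, generate N. *)
Lemma noetherian_ext (A : comNzRingType) (V W : lmodType A)
    (f : {linear V -> W}) :
    noetherian W ->
    (forall N : set V, submodule N -> (forall v, N v -> f v = 0) -> fin_gen N) ->
  noetherian V.
Proof.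
move=> nW nK N Ns.
have [p [w genw]] : fin_gen (f @` N).
  apply: nW; split; first by exists 0; [exact: Ns.1 | rewrite linear0].
  move=> a _ _ [u Nu <-] [v Nv <-]; exists (a *: u + v); first exact: Ns.2.
  by rewrite linearP.
have [q [h genh]] : fin_gen [set v | N v /\ f v = 0].
  apply: nK; last by move=> v [].
  split; first by split; [exact: Ns.1 | rewrite linear0].
  move=> a u v [Nu u0] [Nv v0]; split; first exact: Ns.2.
  by rewrite linearP u0 v0 scaler0 addr0.
have /choice[w' w'P] : forall i, exists u, N u /\ f u = w i.
  by move=> i; have [u Nu <-] := fin_gen_gens genw i; exists u.
apply: (@fin_genI _ _ _ _ (fun i : 'I_(p + q) =>
  match split i with inl j => w' j | inr j => h j end)) => //.
  move=> i; case: (split i) => j; first by case: (w'P j).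
  by have [] := fin_gen_gens genh j.
move=> v Nv; have /genw[c fv] : (f @` N) (f v) by exists v.
have /genh[d vE] : N (v - \sum_i c i *: w' i) /\ f (v - \sum_i c i *: w' i) = 0.
  split.
    by apply: submoduleB => //; apply: submodule_sum => // i; case: (w'P i).
  rewrite linearB linear_sum fv; apply/eqP; rewrite subr_eq0; apply/eqP.
  by apply: eq_bigr => i _; rewrite linearZ; case: (w'P i) => _ ->.
exists (fun i => match split i with inl j => c j | inr j => d j end).
rewrite big_split_ord /=.
under eq_bigr do rewrite (unsplitK (inl _)).
under [X in _ + X]eq_bigr do rewrite (unsplitK (inr _)).
by rewrite -vE addrC subrK.
Qed.

(** Induction on n along the first coordinate, whose kernel is a copy of the row
    vectors of length n - 1. *)
Lemma noetherian_rV (A : comNzRingType) n :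
  noetherian A^o -> noetherian 'rV[A]_n.
Proof.
move=> nA; elim: n => [|n IHn].
  move=> N Ns; apply: (@fin_genI _ _ _ 0 (fun _ => 0)) => // [[]//|v _].
  by exists (fun _ => 0); rewrite big_ord0; apply/rowP; case.
have lin0 : linear (fun v : 'rV[A]_n.+1 => v 0 0 : A^o).
  by move=> a u v; rewrite !mxE.
pose L := GRing.isLinear.Build A 'rV[A]_n.+1 A^o *:%R _ lin0.
pose f : {linear _ -> _} := HB.pack (fun v : 'rV[A]_n.+1 => v 0 0 : A^o) L.
apply: (noetherian_ext (f := f)) => // N Ns N0.
pose emb (v : 'rV[A]_n) : 'rV[A]_n.+1 := row_mx (0 : 'rV_1) v.
have embP a u v : emb (a *: u + v) = a *: emb u + emb v.
  apply/rowP=> i; rewrite !mxE; case: splitP => j _; rewrite !mxE //.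
  by rewrite mulr0 addr0.
have [p [h genh]] : fin_gen [set v | N (emb v)].
  apply: IHn; split=> [|a u v Nu Nv] /=; last by rewrite embP; apply: Ns.2.
  by rewrite /emb row_mx0; apply: Ns.1.
apply: (@fin_genI _ _ _ p (fun i => emb (h i))) => // [i|v Nv].
  exact: (fin_gen_gens genh).
have vE : v = emb (@rsubmx _ 1 1 n v).
  apply/rowP=> i; rewrite mxE; case: splitP => j ij; rewrite !mxE.
    by rewrite -[RHS](N0 _ Nv) /=; congr (v _ _); apply: val_inj; rewrite /= ij [j]ord1.
  by congr (v _ _); apply: val_inj.
have /genh[c vE'] : N (emb (@rsubmx _ 1 1 n v)) by rewrite -vE.
have emb0 : emb 0 = 0 by rewrite /emb row_mx0.
exists c; rewrite vE vE'.
by elim/big_rec2: _ => [//|i u w _ <-]; rewrite embP.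
Qed.

Lemma noetherian_image (A B : comNzRingType) (f : {rmorphism A -> B}) :
  (forall b, exists a, f a = b) -> noetherian A^o -> noetherian B^o.
Proof.
move=> fsurj nA N Ns.
have [n [h genh]] : fin_gen ((fun a : A^o => N (f a)) : set A^o).
  apply: nA; split=> [|a u v Nu Nv]; first by rewrite rmorph0; apply: Ns.1.
  by rewrite rmorphD rmorphM; apply: Ns.2.
apply: (@fin_genI B B^o N n (fun i => f (h i))) => // [i|b Nb].
  exact: (fin_gen_gens genh).
have [a aE] := fsurj b; rewrite -aE in Nb *.
have /genh[c ->] := Nb; exists (fun i => f (c i)).
by rewrite rmorph_sum; apply: eq_bigr => i _; rewrite rmorphM.
Qed.

Lemma noetherian_field (k : fieldType) : noetherian k^o.
Proof.
move=> N Ns; have [[a [a0 Na]]|N0] := pselect (exists a, a != 0 /\ N a).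
  apply: (@fin_genI _ _ _ 1 (fun _ => a)) => // v _.
  exists (fun _ => v / a); rewrite big_ord1.
  by change (v = v / a * a); rewrite divfK.
apply: (@fin_genI _ _ _ 0 (fun _ => 0)) => // [[]//|v Nv].
exists (fun _ => 0); rewrite big_ord0; apply/eqP; apply: contrapT => v0.
by apply: N0; exists v; split=> //; apply/negP.
Qed.

(** Hilbert's basis theorem.  The coefficients c of X^d in members of N of degree
    at most d form an ideal of A, which is generated by those of finitely many
    members f_i.  Let D exceed their degrees.  Subtracting multiples of the f_i
    lowers the degree of any member of N until it is below D, and the members
    of degree below D form a submodule of A^D, which is finitely generated. *)
Lemma noetherian_poly (A : comNzRingType) :
  noetherian A^o -> noetherian {poly A}^o.
Proof.
move=> nA N Ns.
have NM (p q : {poly A}) : N q -> N (p * q) by move=> Nq; apply: submoduleZ.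
have ND (p q : {poly A}) : N p -> N q -> N (p + q).
  exact: (@submoduleD _ {poly A}^o N p q Ns).
have NB (p q : {poly A}) : N p -> N q -> N (p - q).
  exact: (@submoduleB _ {poly A}^o N p q Ns).
have [n [c genc]] : fin_gen ((fun a : A^o => exists (f : {poly A}) d,
    [/\ N f, (size f <= d.+1)%N & f`_d = a]) : set A^o).
  apply: nA; split.
    by exists 0, 0%N; split; [exact: Ns.1 | rewrite size_poly0 | rewrite coef0].
  move=> a u v [f [d [Nf szf fd]]] [g [e [Ng szg ge]]].
  exists (a *: ('X^e * f) + 'X^d * g), (d + e)%N; split.
  - apply: ND; last exact: NM.
    by rewrite -mul_polyC mulrA; apply: NM.
  - rewrite (leq_trans (size_polyD _ _)) // geq_max.
    rewrite (leq_trans (size_scale_leq _ _)) /=.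
      by apply: leq_trans (size_polyMleq _ _) _; rewrite size_polyXn; lia.
    by apply: leq_trans (size_polyMleq _ _) _; rewrite size_polyXn; lia.
  - rewrite coefD coefZ !coefXnM !ltnNge leq_addr leq_addl /=.
    by rewrite addnK addKn fd ge.
have /choice[f /choice[d fP]] := fin_gen_gens genc.
pose D := (\max_i d i).+1.
have dD i : (d i < D)%N by rewrite ltnS leq_bigmax.
have [q [h genh]] : fin_gen [set v : 'rV[A]_D | N (rVpoly v)].
  apply: noetherian_rV => //; split=> /= [|a u v Nu Nv].
    by rewrite linear0; apply: Ns.1.
  by rewrite linearP; apply: ND => //=; rewrite -mul_polyC; apply: NM.
apply: (@fin_genI _ {poly A}^o N q (fun i => rVpoly (h i))) => // [i|p Np].
  exact: (fin_gen_gens genh).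
have gen_low (r : {poly A}) : N r -> (size r <= D)%N ->
    exists c : 'I_q -> {poly A}, r = \sum_i c i * rVpoly (h i).
  move=> Nr szr; have rE : rVpoly (poly_rV r : 'rV_D) = r by rewrite poly_rV_K.
  have /genh[a aE] : N (rVpoly (poly_rV r : 'rV_D)) by rewrite rE.
  exists (fun i => (a i)%:P); rewrite -rE aE linear_sum.
  by apply: eq_bigr => i _; rewrite linearZ /= mul_polyC.
change (exists c : 'I_q -> {poly A}, p = \sum_i c i * rVpoly (h i)).
have [N1 szp] := ubnP (size p); elim: N1 p Np szp => // N1 IH p Np szp.
have [|ltD] := leqP (size p) D; first exact: gen_low.
case szpE : (size p) => [|e]; first by rewrite szpE in ltD.
have De : (D <= e)%N by rewrite szpE ltnS in ltD.
have /genc[a pe] : exists (f : {poly A}) d, [/\ N f, (size f <= d.+1)%N & f`_d = p`_e].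
  by exists p, e; rewrite szpE.
have /choice[b bE] i : exists b : 'I_q -> {poly A}, f i = \sum_j b j * rVpoly (h j).
  have [Nf szf _] := fP i.
  by apply: gen_low => //; apply: leq_trans szf (dD i).
pose r := \sum_i (a i)%:P * 'X^(e - d i) * f i.
have Nr : N r.
  rewrite /r; elim/big_ind: _ => [|u v|i _]; first exact: Ns.1.
    exact: ND.
  by apply: NM; case: (fP i).
have [||w wE] := IH (p - r); first exact: NB.
  suff: (size (p - r)%R <= e)%N by move=> le_e; apply: leq_ltn_trans le_e _;
    rewrite szpE ltnS in szp.
  have szr : (size r <= e.+1)%N.
    apply: leq_trans (size_sum _ _ _) _; apply/bigmax_leqP => i _.
    have [_ szf _] := fP i.
    rewrite mul_polyC -scalerAl; apply: leq_trans (size_scale_leq _ _) _.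
    rewrite (leq_trans (size_polyMleq _ _)) // size_polyXn addSn /=.
    rewrite (leq_trans (leq_add (leqnn _) szf)) // addnS subnK //.
    exact: leq_trans (ltnW (dD i)) De.
  apply/leq_sizeP => j; rewrite leq_eqVlt => /orP[/eqP <-|lt_ej].
    rewrite coefB pe coef_sum; apply/eqP; rewrite subr_eq0; apply/eqP.
    apply: eq_bigr => i _; have [_ _ fi] := fP i.
    have di : (d i <= e)%N by apply: leq_trans (ltnW (dD i)) De.
    rewrite mul_polyC -scalerAl coefZ coefXnM ltnNge leq_subr /= subKn //.
    by rewrite fi.
  rewrite coefB !nth_default ?subr0 ?szpE //.
  exact: leq_trans szr lt_ej.
exists (fun j => w j + \sum_i (a i)%:P * 'X^(e - d i) * b i j).
rewrite -[LHS](subrK r) wE; under [RHS]eq_bigr do rewrite mulrDl.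
rewrite big_split /=; congr (_ + _); rewrite /r.
under [RHS]eq_bigr do rewrite mulr_suml.
rewrite exchange_big /=; apply: eq_bigr => i _.
by rewrite {1}bE mulr_sumr; apply: eq_bigr => j _; rewrite mulrA.
Qed.

(** Ring homomorphisms out of a polynomial ring are compared by this induction on
    constants and variables, without monomials. *)
Lemma mpoly_gen_ind (A : comNzRingType) n (P : {mpoly A[n]} -> Prop) :
    (forall c, P c%:MP) -> (forall i, P 'X_i) ->
    (forall p q, P p -> P q -> P (p + q)) ->
    (forall p q, P p -> P q -> P (p * q)) ->
  forall p, P p.
Proof.
move=> PC PX PD PM p.
have P0 : P 0 by rewrite -mpolyC0.
rewrite (mpolyE p); elim/big_ind: _ => // m _; rewrite -mul_mpolyC; apply: (PM) => //.
rewrite mpolyXE_id; elim/big_ind: _ => [|? ?|i _]; [by rewrite -mpolyC1|exact: (PM)|].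
elim: (m i) => [|e IHe]; first by rewrite expr0 -mpolyC1.
by rewrite exprS; apply: PM.
Qed.

(** Adding one variable: substituting the last variable for X maps polynomials
    with coefficients in k[x_1, ..., x_n] onto k[x_1, ..., x_(n+1)]. *)
Lemma noetherian_mpoly (k : fieldType) n : noetherian {mpoly k[n]}^o.
Proof.
elim: n => [|n IHn].
  apply: (noetherian_image (f := @mpolyC 0 k)); last exact: noetherian_field.
  by elim/mpoly_gen_ind => [c|[]//|_ _ [a <-] [b <-]|_ _ [a <-] [b <-]];
    [exists c|exists (a + b); rewrite rmorphD|exists (a * b); rewrite rmorphM].
pose f : {rmorphism {poly {mpoly k[n]}} -> {mpoly k[n.+1]}} :=
  horner_eval 'X_ord_max \o map_poly (@mwiden n k).
apply: (noetherian_image (f := f)); last exact: noetherian_poly.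
elim/mpoly_gen_ind => [c|i|_ _ [a <-] [b <-]|_ _ [a <-] [b <-]].
- by exists (c%:MP)%:P; rewrite /f /= map_polyC /= /horner_eval hornerC mwidenC.
- have [j ->|->] := unliftP ord_max i.
    exists ('X_j)%:P; rewrite /f /= map_polyC /= /horner_eval hornerC mwidenX.
    by rewrite mnmwiden1; congr 'X_(_); apply: val_inj; rewrite /= /bump leqNgt ltn_ord.
  by exists 'X; rewrite /f /= map_polyX /horner_eval hornerX.
- by exists (a + b); rewrite rmorphD.
- by exists (a * b); rewrite rmorphM.
Qed.

Lemma noetherian_rowspan (A : comNzRingType) (nA : noetherian A^o) n
    (N : set 'rV[A]_n) : submodule N ->
  exists p (B : 'M[A]_(p, n)), forall v, N v <-> exists y, v = y *m B.
Proof.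
move=> Ns; have [p [h genh]] := noetherian_rV nA Ns.
have rowE (c : 'I_p -> A) :
    \sum_i c i *: h i = (\row_i c i) *m (\matrix_(i, j) h i 0 j).
  rewrite mulmx_sum_row; apply: eq_bigr => i _; rewrite mxE; congr (_ *: _).
  by apply/rowP=> j; rewrite !mxE.
exists p, (\matrix_(i, j) h i 0 j) => v; split.
  by move=> /genh[c ->]; exists (\row_i c i).
move=> [y ->]; apply/genh; exists (fun i => y 0 i); rewrite rowE.
by congr (_ *m _); apply/rowP=> i; rewrite !mxE.
Qed.

Definition row_eval (A : comNzRingType) (V : lmodType A) n (h : 'I_n -> V)
  (v : 'rV[A]_n) : V := \sum_i v 0 i *: h i.

Lemma row_eval_is_linear (A : comNzRingType) (V : lmodType A) n (h : 'I_n -> V) :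
  linear (row_eval h).
Proof.
move=> a u v; rewrite /row_eval scaler_sumr -big_split /=; apply: eq_bigr => i _.
by rewrite !mxE scalerDl scalerA.
Qed.
HB.instance Definition _ (A : comNzRingType) (V : lmodType A) n (h : 'I_n -> V) :=
  GRing.isLinear.Build A 'rV[A]_n V *:%R (row_eval h) (row_eval_is_linear h).

Lemma resolution_exists (A : comNzRingType) (V : lmodType A) (M : set V) :
  noetherian A^o -> fin_gen M -> inhabited (free_resolution M).
Proof.
move=> nA [n [h genh]].
(* Each kernel is the row space of some matrix; iterating the choice of such a
   matrix, starting with the relations among the generators, gives the
   differentials.  A state of the iteration packs a matrix with its sizes. *)
have ker_gen p q (B : 'M[A]_(p, q)) : exists s (C : 'M[A]_(s, p)),
    forall v : 'rV_p, v *m B = 0 <-> exists y, v = y *m C.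
  apply: noetherian_rowspan => //; split=> [|a u v Nu Nv]; first exact: mul0mx.
  by rewrite mulmxDl -scalemxAl Nu Nv scaler0 addr0.
have [r [B0 B0P]] : exists s (C : 'M[A]_(s, n)),
    forall v : 'rV_n, row_eval h v = 0 <-> exists y, v = y *m C.
  apply: noetherian_rowspan => //; split=> [|a u v Nu Nv]; first exact: linear0.
  by rewrite linearP /= Nu Nv scaler0 addr0.
pose T := {q & {p & 'M[A]_(p, q)}}.
pose next (t : T) : T := existT _ (projT1 (projT2 t))
  (existT _ (projT1 (cid (ker_gen _ _ (projT2 (projT2 t)))))
            (projT1 (cid (projT2 (cid (ker_gen _ _ (projT2 (projT2 t)))))))).
pose st i := iter i next (existT _ n (existT _ r B0)).
constructor; apply: (@FreeResolution A V M (fun i => projT1 (st i))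
  (fun i => projT2 (projT2 (st i))) (row_eval h)).
- apply/seteqP; split=> [_ [v _ <-]|v /genh[c ->]].
    by apply/genh; exists (fun i => v 0 i).
  exists (\row_i c i) => //; apply: eq_bigr => i _; congr (_ *: _).
  by rewrite mxE.
- exact: B0P.
- move=> i x.
  exact: (projT2 (cid (projT2 (cid (ker_gen _ _ (projT2 (projT2 (st i)))))))).
Qed.

(** * Independence of Tor dimensions from the resolution *)

(** Chain maps and homotopies are built degree by degree.  The invariant P is what
    makes the next component exist, and Q ties consecutive components. *)
Lemma dependent_choice_seq (T : nat -> Type) (P : forall i, T i -> Prop)
    (Q : forall i, T i -> T i.+1 -> Prop) (t0 : T 0%N) :
    P 0%N t0 ->
    (forall i t, P i t -> exists t', P i.+1 t' /\ Q i t t') ->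
  exists f : forall i, T i, f 0%N = t0 /\ forall i, Q i (f i) (f i.+1).
Proof.
move=> P0 next.
pose st := fix st i : {t : T i | P i t} :=
  match i with
  | 0 => exist _ t0 P0
  | j.+1 => let t' := cid (next j _ (proj2_sig (st j))) in
            exist _ (proj1_sig t') (proj1 (proj2_sig t'))
  end.
by exists (fun i => proj1_sig (st i)); split=> // i;
  case: (proj2_sig (cid (next i _ (proj2_sig (st i))))).
Qed.

Lemma factor_rows (A : comNzRingType) p q r (X : 'M[A]_(p, q)) (B : 'M[A]_(r, q)) :
  (forall i, exists y, row i X = y *m B) -> exists Y, X = Y *m B.
Proof.
move=> /choice[y yE]; exists (\matrix_i y i); apply/row_matrixP=> i.
by rewrite row_mul rowK.
Qed.

Section FreeResolution.
Variables (A : comNzRingType) (V : lmodType A) (M : set V).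
Variable F : free_resolution M.

Lemma dif_dif i : dif F i.+1 *m dif F i = 0.
Proof.
apply/row_matrixP=> j; rewrite row_mul row0; apply/dif_exact.
by exists (delta_mx 0 j); rewrite rowE.
Qed.

Lemma dif_exact_mx i p (X : 'M[A]_(p, rk F i.+1)) :
  X *m dif F i = 0 -> exists Y, X = Y *m dif F i.+1.
Proof.
move=> X0; apply: factor_rows => j; apply/dif_exact.
by rewrite -row_mul X0 row0.
Qed.

Lemma aug_dif y : aug F (y *m dif F 0) = 0.
Proof. by apply/aug_exact; exists y. Qed.

Lemma aug_exact_mx p (X : 'M[A]_(p, rk F 0)) :
  (forall i, aug F (row i X) = 0) -> exists Y, X = Y *m dif F 0.
Proof. by move=> X0; apply: factor_rows => j; apply/aug_exact. Qed.

Lemma aug_in x : M (aug F x).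
Proof. by have : range (aug F) (aug F x) by [exists x]; rewrite aug_image. Qed.

Lemma aug_onto u : M u -> exists v, aug F v = u.
Proof. by rewrite -{1}(aug_image F) => -[v _ <-]; exists v. Qed.

End FreeResolution.

(** The component f_i extends to degree i + 1 exactly when it maps boundaries of F
    to boundaries of G; this is the invariant of the construction. *)
Lemma lift_chain_map (A : comNzRingType) (V : lmodType A) (M : set V)
    (F G : free_resolution M) :
  exists f : forall i, 'M[A]_(rk F i, rk G i),
    (forall x, aug G (x *m f 0%N) = aug F x) /\
    forall i, dif F i *m f i = f i.+1 *m dif G i.
Proof.
have /choice[y yE] i : exists y, aug G y = aug F (delta_mx 0 i).
  by apply: aug_onto; apply: aug_in.
pose f0 := \matrix_i y i.
have f0E x : aug G (x *m f0) = aug F x.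
  rewrite mulmx_sum_row linear_sum [in RHS](row_sum_delta x) linear_sum.
  apply: eq_bigr => i _ /=.
  by rewrite rowK !linearZ yE.
have [||f [f0' fE]] := @dependent_choice_seq (fun i => 'M[A]_(rk F i, rk G i))
    (fun i t => exists u, dif F i *m t = u *m dif G i)
    (fun i t t' => dif F i *m t = t' *m dif G i) f0.
- by apply: aug_exact_mx => i; rewrite row_mul f0E rowE aug_dif.
- move=> i t [u uE]; exists u; split=> //; apply: dif_exact_mx.
  by rewrite -mulmxA -uE mulmxA dif_dif mul0mx.
by exists f; split=> // x; rewrite f0'.
Qed.

(** In degree i + 1 the difference of c and of the part of the homotopy already
    built is a cycle, hence a boundary by exactness. *)
Lemma null_homotopy (A : comNzRingType) (V : lmodType A) (M : set V)
    (F : free_resolution M) (c : forall i, 'M[A]_(rk F i, rk F i)) :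
    (forall x, aug F (x *m c 0%N) = 0) ->
    (forall i, dif F i *m c i = c i.+1 *m dif F i) ->
  exists s : forall i, 'M[A]_(rk F i, rk F i.+1),
    c 0%N = s 0%N *m dif F 0 /\
    forall i, c i.+1 = dif F i *m s i + s i.+1 *m dif F i.+1.
Proof.
move=> c0 cE.
have [s0 s0E] : exists s0, c 0%N = s0 *m dif F 0.
  by apply: aug_exact_mx => i; rewrite rowE c0.
have [||s [s0' sE]] := @dependent_choice_seq (fun i => 'M[A]_(rk F i, rk F i.+1))
    (fun i s => (c i.+1 - dif F i *m s) *m dif F i = 0)
    (fun i s s' => c i.+1 = dif F i *m s + s' *m dif F i.+1) s0.
- by rewrite mulmxBl -cE -mulmxA -s0E subrr.
- move=> i s /dif_exact_mx[s' s'E]; exists s'.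
  have cE' : c i.+1 = dif F i *m s + s' *m dif F i.+1 by rewrite -s'E addrC subrK.
  split=> //; rewrite mulmxBl -cE cE' mulmxDr mulmxA dif_dif mul0mx add0r mulmxA.
  by rewrite subrr.
by exists s; split=> //; rewrite s0'.
Qed.

(** If f induces an injective map from Z/B to Z'/B', dimensions compare.  The
    image of Z in the quotient by B' is encoded by the product with
    [f *m cokermx B'], whose kernel on Z lies in B. *)
Lemma homology_rank_leq (k : fieldType) p p1 p2 q q1 q2
    (Z : 'M[k]_(p1, p)) (B : 'M[k]_(p2, p)) (Z' : 'M[k]_(q1, q))
    (B' : 'M[k]_(q2, q)) (f : 'M[k]_(p, q)) :
    (Z *m f <= Z')%MS -> (B' <= Z')%MS ->
    (forall v : 'rV_p, (v <= Z)%MS -> (v *m f <= B')%MS -> (v <= B)%MS) ->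
  (\rank Z - \rank B <= \rank Z' - \rank B')%N.
Proof.
move=> fZ BZ' finj.
have h1 := mxrank_mul_ker Z (f *m cokermx B').
have h2 := mxrank_mul_ker Z' (cokermx B').
have le1 : (\rank (Z :&: kermx (f *m cokermx B')) <= \rank B)%N.
  apply: mxrankS; apply/rV_subP => v; rewrite sub_capmx => /andP[vZ /sub_kermxP vf].
  by apply: finj => //; rewrite submxE -mulmxA vf.
have le2 : (\rank B' <= \rank (Z' :&: kermx (cokermx B')))%N.
  apply: mxrankS; rewrite sub_capmx BZ' /=; apply/sub_kermxP.
  by rewrite mulmx_coker.
have le2' : (\rank (Z' :&: kermx (cokermx B')) <= \rank B')%N.
  apply: mxrankS; apply/rV_subP => v; rewrite sub_capmx => /andP[_ /sub_kermxP vf].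
  by rewrite submxE vf.
have le3 : (\rank (Z *m (f *m cokermx B')) <= \rank (Z' *m cokermx B'))%N.
  by rewrite mulmxA; apply: mxrankS; apply: submxMr.
lia.
Qed.

(** Lifting the identity of M both ways gives a composite F -> G -> F that is
    homotopic to the identity, so the homology of F (x) k embeds into that of
    G (x) k. *)
Lemma tor_dim_leq (k : fieldType) (A : comNzRingType) (eps : {rmorphism A -> k})
    (V : lmodType A) (M : set V) (F G : free_resolution M) i :
  (tor_dim eps F i <= tor_dim eps G i)%N.
Proof.
have [f [faug fE]] := lift_chain_map F G; have [g [gaug gE]] := lift_chain_map G F.
have [||s [s0 sE]] := @null_homotopy _ _ _ F (fun i => f i *m g i - 1%:M).
- by move=> x; rewrite mulmxBr mulmx1 linearB mulmxA gaug faug subrr.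
- move=> j; rewrite mulmxBr mulmxBl mulmx1 mul1mx mulmxA fE -mulmxA gE.
  by rewrite mulmxA.
have difC j : map_mx eps (dif F j) *m map_mx eps (f j) =
    map_mx eps (f j.+1) *m map_mx eps (dif G j).
  by rewrite -!map_mxM fE.
have difC' j : map_mx eps (dif G j) *m map_mx eps (g j) =
    map_mx eps (g j.+1) *m map_mx eps (dif F j).
  by rewrite -!map_mxM gE.
(* In degree 0 every vector is a cycle, which the identity matrix encodes. *)
case: i => [|i].
  have := @homology_rank_leq _ _ _ _ _ _ _ 1%:M (map_mx eps (dif F 0)) 1%:M
    (map_mx eps (dif G 0)) (map_mx eps (f 0%N)).
  rewrite !mxrank1; apply.
  - exact: submx1.
  - exact: submx1.
  move=> v _ /submxP[w wE].
  have := congr1 (map_mx eps) s0; rewrite map_mxB !map_mxM map_mx1.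
  move/(congr1 (mulmx v)); rewrite mulmxBr mulmx1 mulmxA wE -mulmxA difC' => vE.
  have -> : v = w *m (map_mx eps (g 1%N) *m map_mx eps (dif F 0)) -
      v *m (map_mx eps (s 0%N) *m map_mx eps (dif F 0)) by rewrite -vE subKr.
  by rewrite addmx_sub ?eqmx_opp // !mulmxA submxMl.
rewrite /tor_dim.
apply: (@homology_rank_leq _ _ _ _ _ _ _ _ _ _ _ (map_mx eps (f i.+1))).
- by apply/sub_kermxP; rewrite -mulmxA -difC mulmxA mulmx_ker mul0mx.
- by apply/sub_kermxP; rewrite -map_mxM dif_dif map_mx0.
move=> v /sub_kermxP v0 /submxP[w wE].
have := congr1 (map_mx eps) (sE i).
rewrite map_mxB map_mxD !map_mxM map_mx1.
move/(congr1 (mulmx v)); rewrite mulmxBr mulmx1 mulmxA wE -mulmxA difC' => vE.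
have -> : v = w *m (map_mx eps (g i.+2) *m map_mx eps (dif F i.+1)) -
    v *m (map_mx eps (s i.+1) *m map_mx eps (dif F i.+1)).
  have := vE; rewrite mulmxDr mulmxA v0 mul0mx add0r => <-.
  by rewrite subKr.
by rewrite addmx_sub ?eqmx_opp // !mulmxA submxMl.
Qed.

Lemma tor_dim_resolution (k : fieldType) (A : comNzRingType)
    (eps : {rmorphism A -> k}) (V : lmodType A) (M : set V)
    (F G : free_resolution M) i :
  tor_dim eps F i = tor_dim eps G i.
Proof. by apply/eqP; rewrite eqn_leq !tor_dim_leq. Qed.

(** * Reduction modulo a regular element *)

Definition reduction_mod (A C : comNzRingType) (x : A) (pi : {rmorphism A -> C}) :
    Prop :=
  (forall c, exists a, pi a = c) /\ forall a, pi a = 0 <-> exists b, a = x * b.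

Section RegularReduction.
Variables (A C : comNzRingType) (pi : {rmorphism A -> C}) (x : A).
Hypothesis pi_red : reduction_mod x pi.
Hypothesis x_reg : forall a, x * a = 0 -> a = 0.
Variables (V : lmodType A) (M : set V) (W : lmodType C) (N : set W).
Variable theta : V -> W.
Hypothesis theta_lin : forall a u v, M u -> M v ->
  theta (a *: u + v) = pi a *: theta u + theta v.
Hypothesis theta_image : theta @` M = N.
Hypothesis theta_ker : forall u, M u -> theta u = 0 -> exists2 v, M v & u = x *: v.
Hypothesis M_reg : forall u, M u -> x *: u = 0 -> u = 0.

Let pi_surj := pi_red.1.
Let pi_ker a := (pi_red.2 a).1.
Let pi_x : pi x = 0. Proof. by apply/pi_red.2; exists 1; rewrite mulr1. Qed.

Lemma map_mx_surj p q (Y : 'M[C]_(p, q)) : exists X, map_mx pi X = Y.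
Proof.
have /choice[f fE] i : exists g : 'I_q -> A, forall j, pi (g j) = Y i j.
  by have /choice[g gE] j := pi_surj (Y i j); exists g.
by exists (\matrix_(i, j) f i j); apply/matrixP=> i j; rewrite !mxE fE.
Qed.

Lemma map_mx_ker p q (X : 'M[A]_(p, q)) : map_mx pi X = 0 -> exists Y, X = x *: Y.
Proof.
move=> X0; have /choice[f fE] i : exists g : 'I_q -> A, forall j, X i j = x * g j.
  have /choice[g gE] j : exists b, X i j = x * b.
    by apply: pi_ker; have := congr1 (fun Z : 'M_(p, q) => Z i j) X0; rewrite !mxE.
  by exists g.
by exists (\matrix_(i, j) f i j); apply/matrixP=> i j; rewrite !mxE fE.
Qed.

Lemma map_mx_xZ p q (X : 'M[A]_(p, q)) : map_mx pi (x *: X) = 0.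
Proof. by rewrite map_mxZ pi_x scale0r. Qed.

Lemma scale_mx_reg p q (X : 'M[A]_(p, q)) : x *: X = 0 -> X = 0.
Proof.
move=> X0; apply/matrixP=> i j; rewrite [RHS]mxE; apply: x_reg.
by have := congr1 (fun Z : 'M_(p, q) => Z i j) X0; rewrite !mxE.
Qed.

(** Here [theta] exhibits N as M/xM.  A cycle modulo x lifts to v with v d = x z;
    as x is regular, z is a cycle, z = y d by exactness, and v - x y is a cycle
    that lifts the given one.  Hence the reduced complex is exact, and its Tor
    dimensions agree because the residue map of A factors through C. *)
Lemma regular_reduction (k : fieldType) (eps : {rmorphism A -> k})
    (epsC : {rmorphism C -> k}) (F : free_resolution M) :
    (forall a, epsC (pi a) = eps a) ->
  exists F' : free_resolution N, forall i, tor_dim epsC F' i = tor_dim eps F i.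
Proof.
move=> epsE.
pose h i := theta (aug F (delta_mx 0 i)).
have M0 : M 0 by rewrite -(linear0 (aug F)); apply: aug_in.
have th0 : theta 0 = 0.
  have := theta_lin 1 M0 M0; rewrite scaler0 addr0 rmorph1 scale1r.
  by move/eqP; rewrite -subr_eq0 opprD addNKr oppr_eq0 => /eqP.
(* The reduced augmentation is determined by its values on the basis vectors, and
   commutes with reduction modulo x. *)
have hE v : row_eval h (map_mx pi v) = theta (aug F v).
  rewrite [in RHS](row_sum_delta v) linear_sum /row_eval.
  suff [_ ->] : M (\sum_(i < rk F 0) aug F (v 0 i *: delta_mx 0 i)) /\
      theta (\sum_(i < rk F 0) aug F (v 0 i *: delta_mx 0 i)) =
      \sum_(i < rk F 0) pi (v 0 i) *: h i.
    by apply: eq_bigr => i _; rewrite mxE.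
  elim/big_rec2: _ => [|i y1 y2 _ [My2 <-]]; first by [].
  split; last by rewrite linearZ theta_lin //; apply: aug_in.
  have [w <-] := aug_onto F My2; rewrite -linearD; exact: aug_in.
have xF_reg (v : 'rV_(rk F 0)) : aug F (x *: v) = 0 -> aug F v = 0.
  by rewrite linearZ; apply: M_reg; apply: aug_in.
have img : range (row_eval h) = N.
  rewrite -theta_image; apply/seteqP; split=> [_ [w _ <-]|_ [u Mu <-]].
    have [v <-] := map_mx_surj w; rewrite hE; exists (aug F v) => //.
    exact: aug_in.
  have [v <-] := aug_onto F Mu.
  by exists (map_mx pi v); rewrite ?hE.
have ex0 (w : 'rV_(rk F 0)) :
    row_eval h w = 0 <-> exists y, w = y *m map_mx pi (dif F 0).
  split=> [|[y ->]]; last first.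
    by have [y' <-] := map_mx_surj y; rewrite -map_mxM hE aug_dif th0.
  have [v <-] := map_mx_surj w; rewrite hE => /theta_ker[|u]; first exact: aug_in.
  move=> /(aug_onto F)[v' <-]; rewrite -linearZ => /eqP.
  rewrite -subr_eq0 -linearB => /eqP/aug_exact[y yE].
  exists (map_mx pi y); rewrite -map_mxM -yE map_mxB map_mx_xZ.
  by rewrite subr0.
have ex i (w : 'rV_(rk F i.+1)) : w *m map_mx pi (dif F i) = 0 <->
    exists y, w = y *m map_mx pi (dif F i.+1).
  split=> [|[y ->]]; last by rewrite -mulmxA -map_mxM dif_dif map_mx0 mulmx0.
  have [v <-] := map_mx_surj w; rewrite -map_mxM => /map_mx_ker[z zE].
  have [y yE] : exists y, z = y *m dif F i.
    case: i => [|i] in w v z zE *.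
      by apply/aug_exact/xF_reg; rewrite -zE aug_dif.
    apply/dif_exact/scale_mx_reg; rewrite scalemxAl -zE -mulmxA dif_dif.
    by rewrite mulmx0.
  have /dif_exact[u uE] : (v - x *: y) *m dif F i = 0.
    by rewrite mulmxBl zE yE scalemxAl subrr.
  exists (map_mx pi u); rewrite -map_mxM -uE map_mxB map_mx_xZ.
  by rewrite subr0.
exists (FreeResolution (aug := row_eval h) img ex0 ex).
have mapE i : map_mx epsC (map_mx pi (dif F i)) = map_mx eps (dif F i).
  by apply/matrixP=> a b; rewrite !mxE epsE.
by case=> [|i]; rewrite /tor_dim /= !mapE.
Qed.

End RegularReduction.

(** * Semigroup rings and Apery sets *)

(** The quotient ring A/(x), which is nontrivial since x is not a unit. *)
Lemma principal_quotient (A : comNzRingType) (x : A) :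
    (forall b, x * b <> 1) ->
  exists (C : comNzRingType) (pi : {rmorphism A -> C}), reduction_mod x pi.
Proof.
move=> x1.
pose I : {pred A} := fun a => `[< exists b, a = x * b >].
have II : idealr_closed I.
  split; first by apply/asboolP; exists 0; rewrite mulr0.
    by apply/asboolP=> -[b /esym]; apply: x1.
  move=> a _ _ /asboolP[b ->] /asboolP[c ->]; apply/asboolP; exists (a * b + c).
  by rewrite mulrDr mulrCA.
pose K : Idealr.type A := HB.pack I (isIdealr.Build A I II).
exists {ideal_quot K}, (\pi_{ideal_quot K})%qT; split=> [c|a].
  by exists (repr c); exact: reprK.
have piE : (\pi_{ideal_quot K} a == 0)%qT = (a \in I).
  by rewrite -[X in _ == X](rmorph0 \pi_{ideal_quot K})%qT -Quotient.idealrBE subr0.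
by split=> [/eqP|aI]; [rewrite piE => /asboolP|apply/eqP; rewrite piE; apply/asboolP].
Qed.

Lemma rmorphism_factor (A C B : comNzRingType) (pi : {rmorphism A -> C})
    (f : {rmorphism A -> B}) :
    (forall c, exists a, pi a = c) -> (forall a, pi a = 0 -> f a = 0) ->
  exists g : {rmorphism C -> B}, forall a, g (pi a) = f a.
Proof.
move=> /choice[s sK] fK.
have fE a b : pi a = pi b -> f a = f b.
  move=> E; apply/eqP; rewrite -subr_eq0 -rmorphB; apply/eqP/fK.
  by rewrite rmorphB E subrr.
pose g c := f (s c).
have gB : zmod_morphism g.
  by move=> c d; rewrite /g -rmorphB; apply: fE; rewrite rmorphB !sK.
have gM : monoid_morphism g.
  split=> [|c d]; first by rewrite /g -(rmorph1 f); apply: fE; rewrite sK rmorph1.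
  by rewrite /g -rmorphM; apply: fE; rewrite rmorphM !sK.
pose G : {rmorphism C -> B} := HB.pack g (GRing.isZmodMorphism.Build _ _ g gB)
  (GRing.isMonoidMorphism.Build _ _ g gM).
by exists G => a; rewrite /= /g; apply: fE; rewrite sK.
Qed.

Section SgRing.
Variables (k : fieldType) (S : numsg).
Local Notation A := (sgring k S).
Implicit Types f g : A.

Lemma sgvalZ c f : val (c *: f) = c *: val f.
Proof. exact: linearZ. Qed.

Lemma sgcoef_lin c f g j :
  (val (c *: f + g))`_j = c * (val f)`_j + (val g)`_j.
Proof. by rewrite linearP coefD coefZ. Qed.

Lemma sgcoef_sum n (c : 'I_n -> k) (h : 'I_n -> A) j :
  (val (\sum_i c i *: h i))`_j = \sum_i c i * (val (h i))`_j.
Proof.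
rewrite linear_sum coef_sum; apply: eq_bigr => i _.
by rewrite -coefZ; congr (_`_j); exact: sgvalZ.
Qed.

Lemma val_sgmon s : S s -> val (sgmon k S s) = 'X^s.
Proof.
move=> Ss; rewrite /sgmon insubdK //; apply/sgpolyP => i.
by rewrite coefXn; case: (i =P s) => [->|]; rewrite ?eqxx.
Qed.

Lemma sgmon0 : sgmon k S 0 = 1.
Proof. by apply: val_inj; rewrite val_sgmon ?numsg0. Qed.

Lemma sgmonD s t : S s -> S t -> sgmon k S (s + t)%N = sgmon k S s * sgmon k S t.
Proof.
move=> Ss St; apply: val_inj.
by rewrite val_sgmon ?numsgD // rmorphM /= !val_sgmon // exprD.
Qed.

Lemma sgcoef_out f s : ~~ S s -> (val f)`_s = 0.
Proof. by move=> Ss; apply/eqP; apply: contraNT Ss; apply/sgpolyP/(valP f). Qed.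

Lemma sgcoef_mon s i : S s -> (val (sgmon k S s))`_i = (i == s)%:R.
Proof. by move=> Ss; rewrite val_sgmon // coefXn. Qed.

Lemma sgring_ind (P : A -> Prop) :
    P 0 -> (forall c f g, P f -> P g -> P (c *: f + g)) ->
    (forall s, S s -> P (sgmon k S s)) ->
  forall f, P f.
Proof.
move=> P0 PD Pmon f.
have -> : f = \sum_(i < size (val f)) (val f)`_i *: sgmon k S i.
  apply: val_inj; rewrite linear_sum -[LHS]coefK poly_def.
  apply: eq_bigr => i _; rewrite [RHS]sgvalZ.
  have [Si|Si] := boolP (S i); first by rewrite val_sgmon.
  by rewrite sgcoef_out // !scale0r.
elim/big_rec: _ => // i g _ Pg.
have [Si|Si] := boolP (S i); first by apply: (PD) => //; apply: Pmon.
by rewrite sgcoef_out // scale0r add0r.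
Qed.

Variable m : nat.
Hypothesis mS : is_multiplicity S m.
Local Notation x := (sgmon k S m).

Lemma mult_gt0 : (0 < m)%N. Proof. by case: mS. Qed.
Lemma mult_in : S m. Proof. by case: mS. Qed.

Lemma coef_xM g s : (val (x * g))`_s = if (s < m)%N then 0 else (val g)`_(s - m)%N.
Proof. by rewrite rmorphM /= val_sgmon ?mult_in // coefXnM. Qed.

Lemma xM_reg g : x * g = 0 -> g = 0.
Proof.
move=> xg0; apply: val_inj; apply/polyP=> i.
have := congr1 (fun f => (val f)`_(i + m)%N) xg0.
by rewrite coef_xM ltnNge leq_addl addnK raddf0 !coef0.
Qed.

(** The Apery monomials are a basis of k[S]/(x): a monomial t^s with s in S is
    divisible by x = t^m inside k[S] precisely if s is not in the Apery set. *)
Lemma x_dvdP f :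
  (exists g, f = x * g) <-> forall s, apery S m s -> (val f)`_s = 0.
Proof.
split=> [[g ->] s /andP[Ss sm]|f0].
  rewrite coef_xM; case: ltnP => // le_ms; rewrite le_ms /= in sm.
  exact: sgcoef_out.
have dS : drop_poly m (val f) \in @sgpoly k S.
  apply/sgpolyP=> i; rewrite coef_drop_poly; apply: contraNT => Si.
  have [Sim|Sim] := boolP (S (i + m)%N); last by rewrite sgcoef_out.
  by apply/eqP/f0; rewrite /apery /= Sim leq_addl addnK.
exists (SGRing dS); apply: val_inj; rewrite rmorphM /= val_sgmon ?mult_in //.
rewrite -[LHS](poly_take_drop m) mulrC -[RHS]add0r; congr (_ + _).
apply/polyP=> i; rewrite coef_take_poly coef0; case: ltnP => // lt_im.
have [Si|Si] := boolP (S i); last exact: sgcoef_out.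
by apply/f0; rewrite /apery /= Si leqNgt lt_im.
Qed.

Lemma x_nonunit b : x * b <> 1.
Proof.
move=> /(congr1 (fun f => (val f)`_0)); rewrite coef_xM mult_gt0 /= coef1.
by move/eqP; rewrite eq_sym oner_eq0.
Qed.

End SgRing.

Section Apery.
Variables (S : numsg) (m : nat).
Hypothesis mS : is_multiplicity S m.

Lemma apery_in s : apery S m s -> S s.
Proof. by case/andP. Qed.

Lemma addmS s n : S s -> S (s + n * m)%N.
Proof.
move=> Ss; elim: n => [|n IHn]; first by rewrite addn0.
by rewrite mulSn addnCA addnC numsgD // (mult_in mS).
Qed.

Lemma apery_min s t : apery S m s -> S t -> s = t %[mod m] -> (s <= t)%N.
Proof.
move=> /andP[Ss sm] St st; rewrite leqNgt; apply/negP => lt_ts.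
have /dvdnP[q qE] : (m %| s - t)%N by rewrite -eqn_mod_dvd ?(ltnW lt_ts) //; apply/eqP.
case: q qE => [|q] qE; first by lia.
have smE : (s - m = t + q * m)%N by nia.
by move: sm; rewrite smE addmS // andbT; nia.
Qed.

Lemma apery_uniq s t : apery S m s -> apery S m t -> s = t %[mod m] -> s = t.
Proof.
move=> As At st; apply/eqP; rewrite eqn_leq (apery_min As (apery_in At) st).
by rewrite (apery_min At (apery_in As) (esym st)).
Qed.

Lemma apery0 : apery S m 0.
Proof. by rewrite /apery /= numsg0 leqNgt (mult_gt0 mS). Qed.

Lemma aperyN s : S s -> ~~ apery S m s -> (m <= s)%N /\ S (s - m)%N.
Proof. by rewrite /apery /= => -> /=; rewrite negbK => /andP. Qed.

Lemma apery_exists i : exists s, apery S m s /\ s = i %[mod m].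
Proof.
have [N SN] := numsg_cofinite S.
have ex : exists s, S s && (s == i %[mod m]).
  exists (N * m + i)%N; rewrite modnMDl eqxx andbT; apply: SN.
  by rewrite (leq_trans _ (leq_addr _ _)) // leq_pmulr // (mult_gt0 mS).
have [s /andP[Ss /eqP si] smin] := find_ex_minn ex.
exists s; split=> //; rewrite /apery /= Ss /=; apply/negP => /andP[ms Ssm].
have /smin : S (s - m)%N && (s - m == i %[mod m]).
  by rewrite Ssm /= -si -{2}(subnK ms) modnDr.
by have := mult_gt0 mS; lia.
Qed.

(** The Apery set is closed under taking summands within S. *)
Lemma apery_addl s t : S s -> S t -> apery S m (s + t)%N -> apery S m s.
Proof.
move=> Ss St Ast; apply: contraT => /(aperyN Ss)[ms Ssm].
move: Ast; rewrite /apery /= => /andP[_]; rewrite -addnBAC //.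
by rewrite numsgD // andbT; lia.
Qed.

Lemma apery_addr s t : S s -> S t -> apery S m (s + t)%N -> apery S m t.
Proof. by rewrite addnC => Ss St; apply: apery_addl. Qed.

End Apery.

(** The Apery element congruent to i, the coordinate a_i of the Kunz cone when m
    does not divide i; it is 0 when m divides i. *)
Definition apery_rep (S : numsg) m (i : nat) : nat :=
  xget 0%N [set s | apery S m s /\ s = i %[mod m]].

(** For i, j and i + j nonzero modulo m this says that the Kunz inequality of i and j is
    tight for S exactly when it is for T, since an Apery sum a_i + a_j is a_(i+j).
    Stating it with [apery] also covers the classes that are zero modulo m. *)
Definition kunz_equiv (m : nat) (S T : numsg) : Prop :=
  forall i j, apery S m (apery_rep S m i + apery_rep S m j)%N =
              apery T m (apery_rep T m i + apery_rep T m j)%N.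

Section AperyRep.
Variables (S : numsg) (m : nat).
Hypothesis mS : is_multiplicity S m.
Local Notation rep := (apery_rep S m).

Lemma apery_repP i : apery S m (rep i) /\ rep i = i %[mod m].
Proof.
have [s sP] := apery_exists mS i.
have := @xgetPex _ 0%N [set t | apery S m t /\ t = i %[mod m]].
by apply; exists s.
Qed.

Lemma apery_repA i : apery S m (rep i). Proof. by case: (apery_repP i). Qed.
Lemma apery_repS i : S (rep i). Proof. exact: apery_in (apery_repA i). Qed.
Lemma apery_repE i : rep i = i %[mod m]. Proof. by case: (apery_repP i). Qed.

Lemma apery_rep_eq s i : apery S m s -> s = i %[mod m] -> rep i = s.
Proof.
move=> As si; apply: (apery_uniq mS) => //; first exact: apery_repA.
by rewrite si apery_repE.
Qed.

Lemma apery_rep_id s : apery S m s -> rep s = s.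
Proof. by move=> As; apply: apery_rep_eq. Qed.

Lemma apery_rep_mod i j : i = j %[mod m] -> rep i = rep j.
Proof.
move=> ij; apply: apery_rep_eq; first exact: apery_repA.
by rewrite ij apery_repE.
Qed.

Lemma apery_rep_add i j : apery S m (rep i + rep j)%N -> rep (i + j)%N = (rep i + rep j)%N.
Proof.
by move=> Aij; apply: apery_rep_eq => //; rewrite -modnDm !apery_repE modnDm.
Qed.

End AperyRep.

(** * The common Artinian reduction of Kunz equivalent semigroups *)

Lemma kunz_equiv_sym m S T : kunz_equiv m S T -> kunz_equiv m T S.
Proof. by move=> ST i j; rewrite ST. Qed.

Section AperyTransfer.
Variables (k : fieldType) (m : nat).

(** The k-linear map t^(b_i) |-> t^(a_i) on Apery monomials that kills the multiples
    of t^m.  It is multiplicative only modulo t^m. *)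
Definition apery_transfer (T S : numsg) (f : sgring k T) : sgring k S :=
  \sum_(i < m) (val f)`_(apery_rep T m i) *: sgmon k S (apery_rep S m i).

Lemma apery_transfer_is_linear T S : linear (@apery_transfer T S).
Proof.
move=> c f g; rewrite /apery_transfer scaler_sumr -big_split /=.
apply: eq_bigr => i _; rewrite scalerA -scalerDl; congr (_ *: _).
by rewrite -coefZ -coefD; congr (_`_ _); exact: linearP.
Qed.
HB.instance Definition _ T S := GRing.isLinear.Build k (sgring k T) (sgring k S)
  *:%R (@apery_transfer T S) (@apery_transfer_is_linear T S).

Lemma coef_apery_transfer (T S : numsg) (f : sgring k T) s :
    is_multiplicity S m -> is_multiplicity T m -> apery S m s ->
  (val (apery_transfer S f))`_s = (val f)`_(apery_rep T m s).
Proof.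
move=> mS mT As; have m0 := mult_gt0 mS.
rewrite /apery_transfer sgcoef_sum.
rewrite (bigD1 (Ordinal (ltn_pmod s m0))) //= big1 ?addr0 => [|i ni].
  rewrite sgcoef_mon ?(apery_repS mS) //.
  rewrite (@apery_rep_mod S _ mS (s %% m) s) ?modn_mod // (apery_rep_id mS As) eqxx mulr1.
  by rewrite (@apery_rep_mod T _ mT (s %% m) s) ?modn_mod.
rewrite sgcoef_mon ?(apery_repS mS) //; case: eqP => [si|_]; last by rewrite mulr0.
case/eqP: ni; apply: val_inj => /=.
by rewrite si (apery_repE mS) modn_small.
Qed.

(** Both sides have the same coefficients at the Apery elements of T. *)
Lemma apery_transferK (S T : numsg) (f : sgring k T) :
    is_multiplicity S m -> is_multiplicity T m ->
  exists g, f - apery_transfer T (apery_transfer S f) = sgmon k T m * g.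
Proof.
move=> mS mT; apply/(x_dvdP mT) => t At.
rewrite [val _]raddfB coefB coef_apery_transfer // coef_apery_transfer ?apery_repA //.
rewrite [X in _ - (val f)`_X](apery_rep_eq mT At) ?subrr // apery_repE //.
Qed.

Lemma apery_transfer_xM (S T : numsg) (f : sgring k T) :
    is_multiplicity T m -> apery_transfer S (sgmon k T m * f) = 0.
Proof.
move=> mT; rewrite /apery_transfer big1 // => i _.
have /(x_dvdP mT)-> : exists g, sgmon k T m * f = sgmon k T m * g by exists f.
  by rewrite scale0r.
exact: apery_repA.
Qed.

Lemma apery_transfer_mon (S T : numsg) t :
    is_multiplicity S m -> is_multiplicity T m -> T t ->
  apery_transfer S (sgmon k T t) =
    if apery T m t then sgmon k S (apery_rep S m t) else 0.
Proof.
move=> mS mT Tt; rewrite /apery_transfer; case: ifP => At.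
  rewrite (bigD1 (Ordinal (ltn_pmod t (mult_gt0 mT)))) //= big1 ?addr0 => [|i ni].
    rewrite sgcoef_mon // (@apery_rep_mod T _ mT (t %% m) t) ?modn_mod //.
    rewrite (apery_rep_id mT At) eqxx scale1r.
    by rewrite (@apery_rep_mod S _ mS (t %% m) t) ?modn_mod.
  rewrite sgcoef_mon //; case: eqP => [it|_]; last by rewrite scale0r.
  case/eqP: ni; apply: val_inj => /=.
  by rewrite -it (apery_repE mT) modn_small.
rewrite big1 // => i _; rewrite sgcoef_mon //; case: eqP => [it|_]; last by rewrite scale0r.
by rewrite -it (apery_repA mT) in At.
Qed.

(** By bilinearity both factors may be monomials t^s and t^u.  Both sides vanish
    unless s and u are Apery elements; then s + u is one for T exactly when the sum
    of the corresponding Apery elements is one for S, and otherwise the product on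
    the right is divisible by t^m. *)
Lemma apery_transferM (S T : numsg) (f g : sgring k T) :
    is_multiplicity S m -> is_multiplicity T m -> kunz_equiv m S T ->
  exists h, apery_transfer S (f * g) - apery_transfer S f * apery_transfer S g =
    sgmon k S m * h.
Proof.
move=> mS mT ST; set x := sgmon k S m.
pose P (u v : sgring k T) := exists h,
  apery_transfer S (u * v) - apery_transfer S u * apery_transfer S v = x * h.
have PC u v : P u v -> P v u by rewrite /P mulrC [X in _ - X]mulrC.
have P0 u : P u 0 by exists 0; rewrite !mulr0 linear0 mulr0 subrr.
have PD u c v w : P u v -> P u w -> P u (c *: v + w).
  move=> [h1 E1] [h2 E2]; exists (c *: h1 + h2).
  rewrite mulrDr -scalerAr mulrDr -scalerAr -E1 -E2 !linearP /=.
  rewrite mulrDr -scalerAr scalerBr opprD addrACA -scalerBr scalerBr.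
  by [].
change (P f g); elim/sgring_ind: g => [|c v w|t Tt]; [exact: P0|exact: PD|].
apply: PC; elim/sgring_ind: f => [|c v w|s Ts]; [exact: P0|exact: PD|].
rewrite /P -sgmonD // !apery_transfer_mon ?numsgD //.
have [At|nAt] := boolP (apery T m t); last first.
  case: ifP => [Ats|_]; last by exists 0; rewrite mul0r mulr0 subrr.
  by case/negP: nAt; apply: apery_addl Ats.
have [As|nAs] := boolP (apery T m s); last first.
  case: ifP => [Ats|_]; last by exists 0; rewrite !mulr0 subrr.
  by case/negP: nAs; apply: apery_addr Ats.
rewrite -sgmonD ?(apery_repS mS) //.
have := ST t s; rewrite (apery_rep_id mT At) (apery_rep_id mT As).
case: ifP => _ Ats; first by exists 0; rewrite apery_rep_add // mulr0 subrr.
have [] := aperyN _ (negbT Ats); first by rewrite numsgD ?(apery_repS mS).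
move=> le_m Sm; exists (- sgmon k S (apery_rep S m t + apery_rep S m s - m)%N).
by rewrite sub0r mulrN -sgmonD ?(mult_in mS) // subnKC.
Qed.

Lemma apery_transfer_coef0 (S T : numsg) (f : sgring k T) :
    is_multiplicity S m -> is_multiplicity T m ->
  (val (apery_transfer S f))`_0 = (val f)`_0.
Proof.
move=> mS mT; rewrite coef_apery_transfer ?(apery0 mS) //.
by rewrite (apery_rep_id mT (apery0 mT)).
Qed.

End AperyTransfer.

(** With C = k[S]/(t^m), the map q is [apery_transfer] followed by p.  It is
    surjective with kernel (t^m) because the two transfers are mutually inverse
    modulo t^m. *)
Lemma common_reduction (k : fieldType) m (S T : numsg) :
    is_multiplicity S m -> is_multiplicity T m -> kunz_equiv m S T ->
  exists (C : comNzRingType) (p : {rmorphism sgring k S -> C})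
      (q : {rmorphism sgring k T -> C}) (eps : {rmorphism C -> k}),
    [/\ reduction_mod (sgmon k S m) p, reduction_mod (sgmon k T m) q,
        forall f, eps (p f) = sgaug k S f, forall f, eps (q f) = sgaug k T f &
        forall c t, apery T m t ->
          q (c *: sgmon k T t) = p (c *: sgmon k S (apery_rep S m t))].
Proof.
move=> mS mT ST.
have [C [p [psurj pker]]] := principal_quotient (x_nonunit (k := k) mS).
have [|eps epsE] := rmorphism_factor (f := sgaug k S) psurj.
  move=> f /pker[h ->]; rewrite /sgaug /= /coefp.
  by rewrite -[sgval _]/(val _) (coef_xM mS) (mult_gt0 mS).
pose r := @apery_transfer k m T S.
pose q0 f := p (r f).
have qB : zmod_morphism q0 by move=> f g; rewrite /q0 /r linearB rmorphB.
have qM : monoid_morphism q0.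
  split=> [|f g]; rewrite /q0.
    rewrite /r -(sgmon0 k T) apery_transfer_mon ?numsg0 // (apery0 mT).
    by rewrite (apery_rep_id mS (apery0 mS)) sgmon0 rmorph1.
  apply/eqP; rewrite -rmorphM -subr_eq0 -rmorphB; apply/eqP/pker.
  exact: apery_transferM.
pose q : {rmorphism sgring k T -> C} := HB.pack q0
  (GRing.isZmodMorphism.Build _ _ q0 qB) (GRing.isMonoidMorphism.Build _ _ q0 qM).
have qE f : q f = p (r f) by [].
exists C, p, q, eps; split=> //; first split.
- move=> c; have [f <-] := psurj c; exists (apery_transfer m T f).
  apply/esym/eqP; rewrite qE -subr_eq0 -rmorphB; apply/eqP/pker.
  exact: apery_transferK.
- move=> f; rewrite qE; split=> [/pker[h hE]|[h ->]]; last first.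
    by rewrite /r apery_transfer_xM // rmorph0.
  have [g gE] := apery_transferK f mS mT; exists g.
  by rewrite -gE -/(r f) hE apery_transfer_xM // subr0.
- move=> f; rewrite qE epsE /sgaug /= /coefp.
  exact: apery_transfer_coef0.
- move=> c t At; rewrite qE /r linearZ /= apery_transfer_mon ?(apery_in At) //.
  by rewrite At.
Qed.

(** * Resolutions of the residue field *)

Section Splice.
Variables (k : fieldType) (A : comNzRingType) (eps : {rmorphism A -> k}).
Hypothesis eps_surj : forall c, exists a, eps a = c.
Variable H : free_resolution [set a : A^o | eps a = 0].

Let rank i := if i is j.+1 then rk H j else 1%N.
Let dif0 : 'M[A]_(rk H 0, 1) := \col_i aug H (delta_mx 0 i).
Let difs i : 'M[A]_(rank i.+1, rank i) :=
  match i with 0 => dif0 | j.+1 => dif H j end.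

Lemma mul_dif0 (y : 'rV[A]_(rk H 0)) : (y *m dif0) 0 0 = aug H y.
Proof.
rewrite mxE [in RHS](row_sum_delta y) linear_sum; apply: eq_bigr => i _.
by rewrite mxE linearZ.
Qed.

(** A resolution of the kernel of A -> k, preceded by A^1, resolves k.  The added
    differential has its entries in that kernel, so it vanishes over k. *)
Lemma augmentation_resolution : exists F : free_resolution [set: residue eps],
  tor_dim eps F 0 = 1%N /\ forall i, tor_dim eps F i.+1 = tor_dim eps H i.
Proof.
pose h (i : 'I_1) : residue eps := (1 : k).
have hE v : row_eval h v = eps (v 0 0).
  by rewrite /row_eval big_ord1; exact: mulr1.
have img : range (row_eval h) = [set: residue eps].
  apply/seteqP; split=> // c _; have [a aE] := eps_surj c.
  by exists (\row_i a) => //; rewrite hE mxE.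
have ex0 (x : 'rV[A]_(rank 0)) : row_eval h x = 0 <-> exists y, x = y *m difs 0.
  rewrite hE; split=> [x0|[y ->]].
    have [y yE] := aug_onto H (x0 : [set a : A^o | eps a = 0] (x 0 0)).
    by exists y; apply/rowP=> i; rewrite (ord1 i) mul_dif0 yE.
  by rewrite mul_dif0; exact: (aug_in (F := H) y).
have ex i (x : 'rV[A]_(rank i.+1)) :
    x *m difs i = 0 <-> exists y, x = y *m difs i.+1.
  case: i => [|i] in x *; last exact: dif_exact.
  rewrite -aug_exact -mul_dif0; split=> [->|x0]; first by rewrite mxE.
  by apply/rowP=> i; rewrite (ord1 i) x0 mxE.
exists (FreeResolution (aug := row_eval h) img ex0 ex).
have d0 : map_mx eps dif0 = 0.
  apply/matrixP=> i j; rewrite !mxE.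
  exact: (aug_in (F := H) (delta_mx 0 i)).
split; first by rewrite /tor_dim /= d0 mxrank0.
by case=> [|i]; rewrite /tor_dim //= d0 kermx0 mxrank1.
Qed.

End Splice.

(** A member f of the maximal ideal is sent to its coefficient at t^m and to its
    class in C.  The first component is linear over k[S] since m is the least
    positive element of S, so that t^m is not in the square of the maximal ideal;
    both components vanish exactly when f = t^m g with g in the maximal ideal. *)
Lemma maximal_ideal_reduction (k : fieldType) (S : numsg) m
    (C : comNzRingType) (p : {rmorphism sgring k S -> C}) (eps : {rmorphism C -> k})
    (H : free_resolution [set f : (sgring k S)^o | sgaug k S f = 0]) :
    is_multiplicity S m -> reduction_mod (sgmon k S m) p ->
    (forall f, eps (p f) = sgaug k S f) ->
  exists F' : free_resolution
      [set w : (residue eps * C^o)%type | eps w.2 = 0],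
    forall i, tor_dim eps F' i = tor_dim (sgaug k S) H i.
Proof.
move=> mS [psurj pker] epsE; set x := sgmon k S m.
have augE (f : sgring k S) : sgaug k S f = (val f)`_0 by [].
pose th (f : (sgring k S)^o) : (residue eps * C^o)%type := ((val f)`_m, p f).
apply: (@regular_reduction _ _ p x _ _ _ _ _ _ th) => //.
- by move=> f; apply: xM_reg.
- move=> a u v u0 _; rewrite /th /=; congr pair; last by rewrite rmorphD rmorphM.
  change ((val (a * u + v))`_m = eps (p a) * (val u)`_m + (val v)`_m).
  rewrite epsE rmorphD coefD rmorphM coefM; congr (_ + _).
  (* Only the constant term of a contributes to the coefficient at t^m: u has no
     constant term, and a has no terms between 0 and m. *)
  rewrite big_ord_recl subn0 big1 ?addr0 // => j _.
  have [lt_jm|] := ltnP j.+1 m.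
    rewrite sgcoef_out ?mul0r //; apply/negP; have [_ _ min_m] := mS.
    move=> /min_m/(_ (ltn0Sn j)); by rewrite leqNgt lt_jm.
  have := ltn_ord j; rewrite /= /bump => lt_jm le_mj.
  by have -> : (m - (1 + j) = 0)%N; [lia|rewrite [_`_0]u0 mulr0].
- apply/seteqP; split=> [_ [f f0 <-] /=|[c w] /= w0]; first by rewrite epsE.
  have [f fE] := psurj w; have f0 : sgaug k S f = 0 by rewrite -epsE fE.
  exists ((c - (val f)`_m) *: x + f).
    change ((val ((c - (val f)`_m) *: x + f))`_0 = 0).
    rewrite sgcoef_lin sgcoef_mon ?(mult_in mS) //.
    by rewrite [X in _ + X]f0 ltn_eqF ?mulr0 ?addr0 // (mult_gt0 mS).
  rewrite /th; congr pair.
    by rewrite sgcoef_lin sgcoef_mon ?(mult_in mS) // eqxx mulr1 subrK.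
  rewrite rmorphD /= fE; have -> : p ((c - (val f)`_m) *: x) = 0; last exact: add0r.
  by apply/pker; exists ((c - (val f)`_m)%:A); rewrite mulrC -scalerAl mul1r.
- move=> f f0 [fm /pker[g gE]]; exists g => //.
  have := congr1 (fun h : sgring k S => (val h)`_m) gE.
  by rewrite /= coef_xM // ltnn subnn => <-.
- by move=> u _; apply: xM_reg.
Qed.

(** * Resolutions of the defining ideal *)

Section KillVariable.
Variables (k : fieldType) (n : nat) (i0 : 'I_n.+1).

Definition kill_var : {rmorphism {mpoly k[n.+1]} -> {mpoly k[n]}} :=
  mmap (@mpolyC n k) (fun i => if unlift i0 i is Some j then 'X_j else 0).

Definition insert_var : {rmorphism {mpoly k[n]} -> {mpoly k[n.+1]}} :=
  mmap (@mpolyC n.+1 k) (fun j => 'X_(lift i0 j)).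

Lemma kill_varC c : kill_var c%:MP = c%:MP. Proof. exact: mmapC. Qed.
Lemma insert_varC c : insert_var c%:MP = c%:MP. Proof. exact: mmapC. Qed.

Lemma kill_varX i :
  kill_var 'X_i = if unlift i0 i is Some j then 'X_j else 0.
Proof. by rewrite /kill_var /= mmapX mmap1U. Qed.

Lemma insert_varX j : insert_var 'X_j = 'X_(lift i0 j).
Proof. by rewrite /insert_var /= mmapX mmap1U. Qed.

Lemma insert_varK : cancel insert_var kill_var.
Proof.
elim/mpoly_gen_ind => [c|j|p q Ep Eq|p q Ep Eq].
- by rewrite insert_varC kill_varC.
- by rewrite insert_varX kill_varX liftK.
- by rewrite !rmorphD Ep Eq.
- by rewrite !rmorphM Ep Eq.
Qed.

(** The kernel of the substitution is generated by the variable set to 0. *)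
Lemma kill_varK p : exists b, p - insert_var (kill_var p) = 'X_i0 * b.
Proof.
elim/mpoly_gen_ind: p => [c|i|p q [b Eb] [d Ed]|p q [b Eb] [d Ed]].
- by exists 0; rewrite kill_varC insert_varC subrr mulr0.
- rewrite kill_varX; case: unliftP => [j ->|->].
    by exists 0; rewrite insert_varX subrr mulr0.
  by exists 1; rewrite rmorph0 subr0 mulr1.
- by exists (b + d); rewrite !rmorphD mulrDr -Eb -Ed opprD addrACA.
- exists (b * q + insert_var (kill_var p) * d).
  rewrite mulrDr mulrA -Eb mulrCA -Ed !rmorphM mulrBl mulrBr addrA subrK.
  by [].
Qed.

Lemma kill_var_reduction : reduction_mod 'X_i0 kill_var.
Proof.
split=> [q|p]; first by exists (insert_var q); exact: insert_varK.
split=> [p0|[b ->]]; last by rewrite rmorphM kill_varX unlift_none mul0r.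
by have [b] := kill_varK p; rewrite p0 rmorph0 subr0; exists b.
Qed.

Lemma polyaug_kill_var p : polyaug k n (kill_var p) = polyaug k n.+1 p.
Proof.
have augX q (i : 'I_q) : polyaug k q 'X_i = 0.
  by rewrite /polyaug /= mcoeffX mnm1_eq0.
elim/mpoly_gen_ind: p => [c|i|p q Ep Eq|p q Ep Eq].
- by rewrite kill_varC /polyaug /= !mcoeffC !eqxx.
- rewrite kill_varX augX; case: unliftP => [j _|_]; last exact: rmorph0.
  exact: augX.
- by rewrite !rmorphD Ep Eq.
- by rewrite !rmorphM Ep Eq.
Qed.

End KillVariable.

(** The map [sgpres], packaged as a ring homomorphism. *)
Definition sgpres_morph (k : fieldType) (S : numsg) n (g : 'I_n -> nat) :
    {rmorphism {mpoly k[n]} -> sgring k S} :=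
  mmap (in_alg (sgring k S)) (fun j => sgmon k S (g j)).

Lemma sgpres_morphC (k : fieldType) (S : numsg) n (g : 'I_n -> nat) c :
  sgpres_morph k S g c%:MP = c%:A.
Proof. exact: mmapC. Qed.

Lemma sgpres_morphX (k : fieldType) (S : numsg) n (g : 'I_n -> nat) i :
  sgpres_morph k S g 'X_i = sgmon k S (g i).
Proof. by rewrite /sgpres_morph /= mmapX mmap1U. Qed.

Lemma generates_in n (S : numsg) (g : 'I_n -> nat) D i :
  generates S g D -> D i -> S (g i).
Proof.
move=> gen Di; apply/gen; exists (fun j => j == i : nat).
rewrite (bigD1 i) //= eqxx mul1n big1 ?addn0 // => j /andP[_ /negbTE->].
by rewrite mul0n.
Qed.

Lemma sgpres_surj (k : fieldType) n (S : numsg) (g : 'I_n -> nat) :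
  generates S g predT -> forall f, exists p, sgpres_morph k S g p = f.
Proof.
move=> gen; elim/sgring_ind => [|c _ _ [p <-] [q <-]|s /gen[c ->]].
- by exists 0; rewrite rmorph0.
- exists (c%:MP * p + q); rewrite rmorphD rmorphM sgpres_morphC.
  by rewrite mulr_algl.
exists (\prod_j 'X_j ^+ c j); rewrite rmorph_prod.
suff [_ ->] : S (\sum_j c j * g j)%N /\ sgmon k S (\sum_j c j * g j) =
    \prod_j sgmon k S (g j) ^+ c j.
  by apply: eq_bigr => j _; rewrite rmorphXn sgpres_morphX.
elim/big_rec2: _ => [|j y t _ [St Et]]; first by rewrite numsg0 sgmon0.
have Sg : S (g j) by apply: generates_in gen _.
have [Sc Ec] : S (c j * g j)%N /\ sgmon k S (c j * g j) = sgmon k S (g j) ^+ c j.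
  elim: (c j) => [|e [Se Ee]]; first by rewrite mul0n numsg0 sgmon0 expr0.
  by rewrite mulSn numsgD // sgmonD // Ee exprS.
by rewrite numsgD // sgmonD // Ec Et.
Qed.

(** Setting to 0 the variable that maps to t^m sends I onto the kernel of the
    induced map to C: if q goes to a multiple t^m f in k[S] and r is a preimage of
    f, then q - x_(i0) r lies in I.  The variable is regular modulo I as t^m is
    regular in k[S].  The target map is given by h and u, so that two semigroups
    with the same h and u reduce to the same ideal. *)
Lemma defining_ideal_reduction (k : fieldType) (S : numsg) m n
    (g : 'I_n.+1 -> nat) (i0 : 'I_n.+1)
    (C : comNzRingType) (p : {rmorphism sgring k S -> C})
    (h : {rmorphism k -> C}) (u : 'I_n -> C)
    (G : free_resolution [set q : {mpoly k[n.+1]}^o | sgpres S g q = 0]) :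
    is_multiplicity S m -> reduction_mod (sgmon k S m) p ->
    generates S g predT -> g i0 = m ->
    (forall c, h c = p (c%:A)) -> (forall j, u j = p (sgmon k S (g (lift i0 j)))) ->
  exists G' : free_resolution [set q : {mpoly k[n]}^o | mmap h u q = 0],
    forall i, tor_dim (polyaug k n) G' i = tor_dim (polyaug k n.+1) G i.
Proof.
move=> mS [psurj pker] gen gi0 hE uE.
pose P := sgpres_morph k S g; pose phi : {rmorphism {mpoly k[n]} -> C} := mmap h u.
have square q : phi (kill_var k i0 q) = p (P q).
  elim/mpoly_gen_ind: q => [c|i|q r Eq Er|q r Eq Er].
  - by rewrite kill_varC /P sgpres_morphC -hE; exact: mmapC.
  - rewrite kill_varX /P sgpres_morphX; case: unliftP => [j ->|->].
      by rewrite -uE /phi /= mmapX mmap1U.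
    by rewrite rmorph0; apply/esym/pker; exists 1; rewrite mulr1 gi0.
  - by rewrite !rmorphD Eq Er.
  - by rewrite !rmorphM Eq Er.
have X0 : 'X_i0 != 0 :> {mpoly k[n.+1]}.
  by apply/eqP => /(congr1 (mcoeff U_(i0))); rewrite mcoeffXU eqxx mcoeff0;
    move/eqP; rewrite oner_eq0.
have Xreg (q : {mpoly k[n.+1]}) : 'X_i0 * q = 0 -> q = 0.
  by move=> /eqP; rewrite mulf_eq0 (negbTE X0) => /eqP.
apply: (@regular_reduction _ _ (kill_var k i0) 'X_i0 _ _ {mpoly k[n.+1]}^o _
  {mpoly k[n]}^o _ (kill_var k i0)).
- exact: kill_var_reduction.
- exact: Xreg.
- by move=> a v w _ _; rewrite rmorphD rmorphM.
- apply/seteqP; split=> [_ [q q0 <-]|q q0].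
    by change (phi (kill_var k i0 q) = 0); rewrite square [P q]q0 rmorph0.
  have /pker[f fE] : p (P (insert_var k i0 q)) = 0.
    by rewrite -square insert_varK.
  have [r rE] := sgpres_surj gen f.
  exists (insert_var k i0 q - 'X_i0 * r).
    change (P (insert_var k i0 q - 'X_i0 * r) = 0).
    by rewrite rmorphB rmorphM /P sgpres_morphX gi0 rE -fE subrr.
  by rewrite rmorphB insert_varK rmorphM kill_varX unlift_none mul0r subr0.
- move=> q q0 /(kill_var_reduction k i0).2[r rE]; exists r => //.
  change (P r = 0); apply: (xM_reg mS); rewrite -gi0 -sgpres_morphX -rmorphM -rE.
  exact: q0.
- by move=> q _; apply: Xreg.
- exact: polyaug_kill_var.
Qed.

(** * Minimal generators of Kunz equivalent semigroups *)

Section MinimalGenerators.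
Variable m : nat.

Lemma gens_sum_in (S : numsg) n (g c : 'I_n -> nat) (D : pred 'I_n) :
  (forall j, D j -> S (g j)) -> S (\sum_(j | D j) c j * g j)%N.
Proof.
move=> Sg; elim/big_ind: _ => [|s t|j Dj]; [exact: numsg0|exact: numsgD|].
elim: (c j) => [|e IHe]; first by rewrite mul0n numsg0.
by rewrite mulSn numsgD // Sg.
Qed.

Lemma mult_generator (S : numsg) n (g : 'I_n -> nat) (D : pred 'I_n) :
  is_multiplicity S m -> generates S g D -> exists2 i, D i & g i = m.
Proof.
move=> mS gen; have /gen[c mE] := mult_in mS.
have [i /andP[Di ci]|c0] := pickP [pred i | D i & (0 < c i * g i)%N].
  have le_m : (c i * g i <= m)%N by rewrite mE (bigD1 i) //= leq_addr.
  have [_ _ min_m] := mS; move: ci; rewrite /= muln_gt0 => /andP[ci gi0].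
  have le_mg := min_m _ (generates_in gen Di) gi0.
  exists i => //; apply/eqP; rewrite eqn_leq le_mg andbT.
  by apply: leq_trans le_m; rewrite leq_pmull.
have m0 := mult_gt0 mS; move: m0; rewrite mE big1 // => i Di.
by have := c0 i; rewrite /= Di /= lt0n => /negbFE/eqP.
Qed.

Lemma mult_not_apery (S : numsg) : ~~ apery S m m.
Proof. by rewrite /apery /= subnn numsg0 leqnn andbF. Qed.

(** If g_j - m were in S for another generator g_j, then g_j would be a sum of m and
    of other generators, hence redundant. *)
Lemma mingens_apery (S : numsg) n (g : 'I_n -> nat) :
    is_multiplicity S m -> is_mingens S g ->
  exists2 i, g i = m & forall j, j != i -> apery S m (g j).
Proof.
move=> mS [gen mingen]; have [i _ gi] := mult_generator mS gen.
exists i => // j ji; have Sgj := generates_in gen (erefl : predT j).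
apply: contraT => /(aperyN Sgj)[le_m /gen[c cE]].
have cj : c j = 0%N.
  have : (c j * g j <= g j - m)%N by rewrite cE (bigD1 j) //= leq_addr.
  by have := mult_gt0 mS; nia.
suff /mingen/(_ j) : generates S g (predC1 j) by rewrite /= eqxx.
move=> s; split=> [/gen[e ->]|[e ->]]; last first.
  by apply: gens_sum_in => l _; apply: (generates_in gen).
(* Every use of g_j is replaced by its expression m + sum of c_l g_l. *)
exists (fun l => e l + e j * (c l + (l == i)))%N.
have gjE : g j = (\sum_(l | l != j) (c l + (l == i)) * g l)%N.
  rewrite -(subnKC le_m) cE (bigD1 j) //= cj mul0n add0n.
  under [RHS]eq_bigr do rewrite mulnDl.
  rewrite big_split /= addnC; congr addn.
  rewrite (bigD1 i) 1?eq_sym //= eqxx mul1n gi big1 ?addn0 // => l /andP[_ /negbTE->].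
  by rewrite mul0n.
rewrite (bigD1 j) //= gjE big_distrr -big_split /=; apply: eq_bigr => l _.
by rewrite [RHS]mulnDl mulnA addnC.
Qed.

Variables (S T : numsg).
Hypotheses (mS : is_multiplicity S m) (mT : is_multiplicity T m).
Hypothesis ST : kunz_equiv m S T.

(** The passage from Apery elements of S to those of T is additive on sums that stay
    in the Apery set: this is what Kunz equivalence provides. *)
Lemma apery_rep_additive s t : S s -> S t -> apery S m (s + t)%N ->
  apery_rep T m (s + t)%N = (apery_rep T m s + apery_rep T m t)%N.
Proof.
move=> Ss St Ast; apply: apery_rep_add => //; rewrite -ST.
by rewrite !apery_rep_id ?(apery_addl Ss St) ?(apery_addr Ss St).
Qed.

Variables (n : nat) (g : 'I_n -> nat) (i0 : 'I_n).
Hypothesis gi0 : g i0 = m.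
Hypothesis g_apery : forall j, j != i0 -> apery S m (g j).

Definition transfer_gens (U : numsg) (j : 'I_n) : nat :=
  if j == i0 then m else apery_rep U m (g j).

Lemma transfer_gens_in j : T (transfer_gens T j).
Proof. by rewrite /transfer_gens; case: ifP; rewrite (mult_in mT, apery_repS mT). Qed.

(** A summand m cannot occur in an Apery element, so every summand is a multiple of
    an Apery generator, and additivity applies. *)
Lemma apery_rep_sum (D : pred 'I_n) (c : 'I_n -> nat) :
    apery S m (\sum_(j | D j) c j * g j)%N ->
  apery_rep T m (\sum_(j | D j) c j * g j)%N =
    (\sum_(j | D j) c j * transfer_gens T j)%N.
Proof.
have Sg j : S (g j).
  by have [->|/g_apery/apery_in//] := eqVneq j i0; rewrite gi0 (mult_in mS).
have rep0 : apery_rep T m 0 = 0%N := apery_rep_id mT (apery0 mT).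
have multiple j e : S (e * g j)%N /\ (apery S m (e * g j)%N ->
    apery_rep T m (e * g j)%N = (e * transfer_gens T j)%N).
  elim: e => [|e [Se IHe]]; first by rewrite !mul0n numsg0.
  rewrite !mulSn numsgD //; split=> // Ae.
  have Aj := apery_addl (Sg j) Se Ae.
  rewrite apery_rep_additive // IHe ?(apery_addr (Sg j) Se Ae) // /transfer_gens.
  case: eqP => // ji; move: Aj; rewrite ji gi0.
  by rewrite (negbTE (mult_not_apery S)).
pose K s t := S s /\ (apery S m s -> apery_rep T m s = t).
suff [] : K (\sum_(j | D j) c j * g j)%N (\sum_(j | D j) c j * transfer_gens T j)%N by [].
elim/big_rec2: _ => [|j t s _ [Ss IHs]]; first by split; [exact: numsg0|].
have [Sc IHc] := multiple j (c j); split; first exact: numsgD.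
move=> A; rewrite apery_rep_additive // IHc ?(apery_addl Sc Ss A) //.
by rewrite IHs ?(apery_addr Sc Ss A).
Qed.

(** Subtracting m reduces to Apery elements of T; such an element corresponds to an
    Apery element of S, whose expression by generators is transported. *)
Lemma transfer_generates (D : pred 'I_n) :
  D i0 -> generates S g D -> generates T (transfer_gens T) D.
Proof.
move=> Di0 gen t; split=> [|[c ->]]; last first.
  by apply: gens_sum_in => j _; exact: transfer_gens_in.
have [N] := ubnP t; elim: N t => // N IH t le_t Tt.
have [At|] := boolP (apery T m t).
  have /gen[c cE] := apery_repS mS t.
  exists c; rewrite -apery_rep_sum -cE ?(apery_repA mS) //.
  by rewrite (apery_rep_eq mT At) // (apery_repE mS).
move=> /(aperyN Tt)[le_m /IH[|c cE]].
  by have := mult_gt0 mS; lia.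
exists (fun j => (j == i0) + c j)%N; rewrite -(subnKC le_m) cE.
under [RHS]eq_bigr do rewrite mulnDl.
rewrite big_split /=; congr addn.
rewrite (bigD1 i0) //= eqxx mul1n {1}/transfer_gens eqxx big1 ?addn0 // => j.
by move=> /andP[_ /negbTE->]; rewrite mul0n.
Qed.

End MinimalGenerators.

(** Minimality is transported back: a generating subfamily for T contains m, and
    its transfer to S is the corresponding subfamily of g. *)
Lemma mingens_transfer m (S T : numsg) n (g : 'I_n -> nat) i0 :
    is_multiplicity S m -> is_multiplicity T m -> kunz_equiv m S T ->
    g i0 = m -> (forall j, j != i0 -> apery S m (g j)) -> is_mingens S g ->
  is_mingens T (transfer_gens m g i0 T).
Proof.
move=> mS mT ST gi0 gA [gen mingen]; split.
  exact: transfer_generates gen.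
move=> D genD; apply: mingen.
have g'i0 : transfer_gens m g i0 T i0 = m by rewrite /transfer_gens eqxx.
have g'A j : j != i0 -> apery T m (transfer_gens m g i0 T j).
  by move=> /negbTE ji; rewrite /transfer_gens ji; apply: apery_repA.
have Di0 : D i0.
  have [i Di] := mult_generator mT genD.
  have [<- //|/g'A Ai iE] := eqVneq i i0.
  by rewrite iE (negbTE (mult_not_apery m T)) in Ai.
have <- : transfer_gens m (transfer_gens m g i0 T) i0 S = g.
  apply/funext => j; rewrite /transfer_gens; case: (eqVneq j i0) => [->|ji] //.
  by apply: apery_rep_eq (gA _ ji) _; rewrite ?apery_repE.
exact: (transfer_generates mT mS (kunz_equiv_sym ST)).
Qed.

(** * Faces of the Kunz cone *)

Section Faces.
Variables (R : realType) (m : nat) (F : set 'rV[R]_m.-1).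
Hypothesis F_face : is_face (kunz_cone R m) F.

(** From z in the relative interior one can move within the face slightly away from
    w.  The functional z_i + z_j - z_l is nonnegative on the cone and zero at z; if
    it were positive at w, it would be negative at the displaced point. *)
Lemma relint_tight (z w : 'rV[R]_m.-1) (i j l : 'I_m.-1) :
    relint F z -> relint F w -> (i.+1 + j.+1 = l.+1 %[mod m])%N ->
  z 0 i + z 0 j = z 0 l -> w 0 i + w 0 j = w 0 l.
Proof.
move=> [Fz [e e0 ball]] [Fw _] ijl tight.
have FC y : F y -> kunz_cone R m y by case: F_face => f _ -> [].
(* The step t is such that the displacement t (z - w) is smaller than e in each
   coordinate. *)
pose N := 1 + \sum_a `|z 0 a - w 0 a|.
have N0 : 0 < N by rewrite ltr_wpDr // sumr_ge0.
pose t := e / N; have t0 : 0 < t by rewrite divr_gt0.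
pose y := z + t *: (z - w).
have Fy : F y.
  apply: ball => [|a].
    exists 2%N, (fun a => if a == ord0 then 1 + t else - t),
      (fun a => if a == ord0 then z else w).
    split=> [a||]; first by case: ifP.
      by rewrite !big_ord_recl big_ord0 /= addr0 addrK.
    rewrite !big_ord_recl big_ord0 /= addr0 /y scalerBr scalerDl scale1r scaleNr.
    by rewrite addrA.
  rewrite !mxE [X in Num.norm X]addrC addKr normrM gtr0_norm // /t mulrAC ltr_pdivrMr //.
  rewrite ltr_pM2l // /N (bigD1 a) //= addrCA ltrDl.
  by rewrite ltr_wpDr // sumr_ge0.
have [_ /(_ _ _ _ ijl)] := FC _ Fy; have [_ /(_ _ _ _ ijl) wl] := FC _ Fw.
rewrite !mxE -tight => yl; apply/eqP; rewrite eq_le wl andbT.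
have : t * (w 0 i + w 0 j - w 0 l) <= 0 by lra.
by rewrite pmulr_rle0 // subr_le0.
Qed.

Lemma lies_in_face_rep (S : numsg) : is_multiplicity S m -> lies_in_face S F ->
  relint F (\row_i (apery_rep S m i.+1)%:R).
Proof.
move=> mS [a [aP Fa]].
suff -> : \row_i (apery_rep S m i.+1)%:R = \row_i (a i)%:R :> 'rV[R]_m.-1 by [].
apply/rowP=> i; rewrite !mxE; congr _%:R.
by have [Aa ai] := aP i; apply: apery_rep_eq.
Qed.

(** If m divides i or j, one of the summands is 0.  If m divides i + j but not i, a
    sum of the two representatives is a positive multiple of m, hence not in the
    Apery set.  Otherwise the claim is that tightness carries over. *)
Lemma face_apery_imp (S T : numsg) i j :
    is_multiplicity S m -> is_multiplicity T m ->
    lies_in_face S F -> lies_in_face T F ->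
  apery S m (apery_rep S m i + apery_rep S m j)%N ->
  apery T m (apery_rep T m i + apery_rep T m j)%N.
Proof.
move=> mS mT SF TF; have m0 := mult_gt0 mS.
have rep0 (U : numsg) a : is_multiplicity U m -> (a %% m)%N = 0%N -> apery_rep U m a = 0%N.
  by move=> mU am; apply: apery_rep_eq (apery0 mU) _ => //; rewrite am mod0n.
have [i0|i0] := eqVneq (i %% m)%N 0%N.
  by rewrite !(rep0 _ i) // !add0n => _; apply: apery_repA.
have [j0|j0] := eqVneq (j %% m)%N 0%N.
  by rewrite !(rep0 _ j) // !addn0 => _; apply: apery_repA.
move=> A; have := apery_rep_add mS A.
have [ij0|ij0] := eqVneq ((i + j) %% m)%N 0%N.
  rewrite rep0 // => /esym/eqP; rewrite addn_eq0 => /andP[/eqP ri _].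
  by have := apery_repE mS i; rewrite ri mod0n => /esym/eqP; rewrite (negbTE i0).
have ordP a : (a %% m)%N != 0%N -> exists b : 'I_m.-1, b.+1 = (a %% m)%N.
  move=> a0; have am := ltn_pmod a m0.
  have lt_b : ((a %% m).-1 < m.-1)%N by lia.
  by exists (Ordinal lt_b) => /=; lia.
have [[[a aE] [b bE]] [c cE]] := (ordP _ i0, ordP _ j0, ordP _ ij0).
have repE (U : numsg) d (e : 'I_m.-1) : is_multiplicity U m -> e.+1 = (d %% m)%N ->
    apery_rep U m d = apery_rep U m e.+1.
  by move=> mU eE; apply: apery_rep_mod => //; rewrite eE modn_mod.
rewrite (repE _ _ _ mS aE) (repE _ _ _ mS bE) (repE _ _ _ mS cE) => tight.
have abc : (a.+1 + b.+1 = c.+1 %[mod m])%N by rewrite aE bE cE modnDm modn_mod.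
have := relint_tight (lies_in_face_rep mS SF) (lies_in_face_rep mT TF) abc.
rewrite !mxE tight -!natrD => /(_ erefl)/eqP; rewrite eqr_nat => /eqP.
rewrite (repE _ _ _ mT aE) (repE _ _ _ mT bE) => ->.
exact: apery_repA.
Qed.

Lemma face_kunz_equiv (S T : numsg) :
    is_multiplicity S m -> is_multiplicity T m ->
    lies_in_face S F -> lies_in_face T F -> kunz_equiv m S T.
Proof. by move=> mS mT SF TF i j; apply/idP/idP; apply: face_apery_imp. Qed.

End Faces.

(** * Invariance of Golodness *)

Lemma noetherian_sgring (k : fieldType) (S : numsg) n (g : 'I_n -> nat) :
  generates S g predT -> noetherian (sgring k S)^o.
Proof.
by move=> gen; apply: noetherian_image (sgpres_surj gen) _; exact: noetherian_mpoly.
Qed.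

Lemma kernel_resolution (A : comNzRingType) (B : nzRingType) (f : {rmorphism A -> B}) :
  noetherian A^o -> inhabited (free_resolution [set a : A^o | f a = 0]).
Proof.
move=> nA; apply: resolution_exists => //; apply: nA.
split=> [|a u v u0 v0] /=; first exact: rmorph0.
by rewrite rmorphD rmorphM u0 v0 mulr0 addr0.
Qed.

(** The given resolutions for S are compared, over the common reduction, with
    resolutions for T; equality of all Tor dimensions transports the identity of
    power series. *)
Lemma golod_transfer (k : fieldType) m (S T : numsg) :
    is_multiplicity S m -> is_multiplicity T m -> kunz_equiv m S T ->
  golod k S -> golod k T.
Proof.
move=> mS mT ST [n [g [F [G [mg golodE]]]]].
case: n => [|n] in g F G mg golodE *; first by have [[]] := mingens_apery mS mg.
have [i0 gi0 gA] := mingens_apery mS mg.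
pose g' := transfer_gens m g i0 T.
have mg' : is_mingens T g' := mingens_transfer mS mT ST gi0 gA mg.
have [C [p [q [eps [pred qred pE qE pq]]]]] := common_reduction k mS mT ST.
have aug_surj (U : numsg) c : exists f, sgaug k U f = c.
  exists (c%:A); change ((val (c *: (1 : sgring k U)))`_0 = c).
  rewrite -(sgmon0 k U) -[X in val X]addr0 sgcoef_lin sgcoef_mon ?numsg0 //.
  by rewrite eqxx mulr1 raddf0 coef0 addr0.
have [H] := kernel_resolution (sgaug k S) (noetherian_sgring (k := k) mg.1).
have [H'] := kernel_resolution (sgaug k T) (noetherian_sgring (k := k) mg'.1).
have [G'] := kernel_resolution (sgpres_morph k T g') (@noetherian_mpoly k n.+1).
have [E [E0 ES]] := augmentation_resolution (aug_surj S) H.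
have [E' [E'0 E'S]] := augmentation_resolution (aug_surj T) H'.
have [K KE] := maximal_ideal_reduction H mS pred pE.
have [K' K'E] := maximal_ideal_reduction H' mT qred qE.
have torR i : tor_dim (sgaug k T) E' i = tor_dim (sgaug k S) F i.
  rewrite -(tor_dim_resolution _ E F); case: i => [|i]; first by rewrite E0 E'0.
  by rewrite ES E'S -KE -K'E; apply: tor_dim_resolution.
pose h : {rmorphism k -> C} := p \o in_alg (sgring k S).
pose u (j : 'I_n) := p (sgmon k S (g (lift i0 j))).
have hq c : h c = q (c%:A).
  rewrite -(sgmon0 k T) pq ?(apery0 mT) // (apery_rep_id mS (apery0 mS)).
  by rewrite sgmon0.
have uq j : u j = q (sgmon k T (g' (lift i0 j))).
  have nj : lift i0 j != i0 by rewrite eq_sym neq_lift.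
  rewrite /g' /transfer_gens (negbTE nj) -[X in q X]scale1r pq ?(apery_repA mT) //.
  by rewrite scale1r (apery_rep_eq mS (gA _ nj)) // (apery_repE mT).
have g'i0 : g' i0 = m by rewrite /g' /transfer_gens eqxx.
have [L LE] := defining_ideal_reduction G mS pred mg.1 gi0
  (fun c => erefl : h c = p (c%:A)) (fun j => erefl : u j = _).
have [L' L'E] := defining_ideal_reduction G' mT qred mg'.1 g'i0 hq uq.
have torQ i : tor_dim (polyaug k n.+1) G' i = tor_dim (polyaug k n.+1) G i.
  by rewrite -LE -L'E; apply: tor_dim_resolution.
exists n.+1, g', E', G'; split=> // PR PQ i; apply: etrans (golodE i).
apply: eq_bigr => j _; rewrite /PR torR; congr (_ * _).
by rewrite /one_sub_z2; case: (_ - _)%N => [|[|a]] //; rewrite /PQ torQ.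
Qed.

Theorem corollary3p6 (R : realType) (k : fieldType) (m : nat) (hm : (2 <= m)%N)
    (F : set 'rV[R]_m.-1) (hF : is_face (kunz_cone R m) F) :
  (forall S : numsg, is_multiplicity S m -> lies_in_face S F -> golod k S) \/
  (forall S : numsg, is_multiplicity S m -> lies_in_face S F -> ~ golod k S).
Proof.
have [[S [mS SF GS]]|none] := pselect (exists S : numsg,
  [/\ is_multiplicity S m, lies_in_face S F & golod k S]).
  left=> T mT TF; apply: (golod_transfer mS mT _ GS).
  exact: (face_kunz_equiv hF).
by right=> T mT TF GT; apply: none; exists T.
Qed.
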